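(* Let $\xi=\{\xi_{ml}\}_{m\ge0,\,0\le l\le L_m}$ be a subnormal sequence, let $a_{ml}$ be real numbers, and let $$u(x,\xi)=\sum_{m=0}^\infty\sum_{l=0}^{L_m}a_{ml}\,\xi_{ml}\,r^m\,Y_{ml}\Big(\frac xr\Big),\qquad r=|x|.$$ Suppose there exist an increasing sequence $n_0<n_1<n_2<\cdots$ of positive integers and constants $C_1,C_2>0$ such that for all $k$ we have $g(n_{k+1})\le C_1g(n_k)$ and $$\sum_{i=1}^k\sqrt{\Big(\sum_{m=n_{i-1}+1}^{n_i}m^2|\mathbf a_m|^2\Big)\log n_i}\le\frac{C_2}{w(1-1/n_k)}.$$ Then $u\in\mathcal B_w$ almost surely.
   Context: Let $d\ge1$, let $\mathbf B$ be the open unit ball of $\mathbf R^{d+1}$ and $S^d$ its boundary sphere. The weight $w$ is a positive decreasing function on $[0,1)$ with $\lim_{r\to1^-}w(r)=0$, satisfying $w(1-t/2)\ge B\,w(1-t)$ for $0<t\le1$ and some constant $B>0$. Put $v=1/w$ and $g(x)=v(1-1/x)=1/w(1-1/x)$ for $x\ge 1$. The Bloch-type space $\mathcal B_w$ is the set of harmonic functions $u$ on $\mathbf B$ with $\|u\|_{\mathcal B_w}=|u(0)|+\sup_{z\in\mathbf B}w(|z|)|\nabla u(z)|<\infty$. For each $m\ge 0$, $Y_{m0},\dots,Y_{mL_m}$ are real spherical harmonics of degree $m$ on $S^d$ (finitely many, $L_m$ depending on the dimension), normalized so that $\|Y_{ml}\|_\infty\le 1$ on $S^d$; $r^mY_{ml}(x/r)$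 is the corresponding homogeneous harmonic polynomial of degree $m$. Write $\mathbf a_m=(a_{m0},\dots,a_{mL_m})$ and $|\mathbf a_m|^2=\sum_{l=0}^{L_m}|a_{ml}|^2$. A real random variable $\omega$ is subnormal if $\mathcal E(e^{\lambda\omega})\le e^{\lambda^2/2}$ for all $\lambda\in\mathbf R$ ($\mathcal E$ denotes expectation). A subnormal sequence is a sequence of independent subnormal random variables. *)

(* Defs.v *)
From HB Require Import structures.
From mathcomp Require Import all_boot all_order all_algebra.
From mathcomp Require Import all_classical all_reals all_analysis.
(* The notations of mpoly clash with those of analysis. *)
From mathcomp Require Import -(notations) mpoly.

Set Implicit Arguments.
Unset Strict Implicit.
Unset Printing Implicit Defensive.

Import Order.TTheory GRing.Theory Num.Theory.
Import numFieldNormedType.Exports.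

Local Open Scope classical_set_scope.
Local Open Scope ring_scope.

(* The Euclidean norm; the library norm on row vectors is the sup norm. *)
Definition enorm (R : realType) (n : nat) (x : 'rV[R]_n) : R :=
  Num.sqrt (\sum_(i < n) x 0 i ^+ 2).

Definition unit_ball (R : realType) (n : nat) : set 'rV[R]_n :=
  [set x | enorm x < 1].

Definition unit_sphere (R : realType) (n : nat) : set 'rV[R]_n :=
  [set x | enorm x = 1].

Definition partial (R : realType) (n : nat) (i : 'I_n.+1)
    (u : 'rV[R]_n.+1 -> R) : 'rV[R]_n.+1 -> R :=
  fun x => 'D_(delta_mx 0 i) u x.

Definition grad_norm (R : realType) (n : nat)
    (u : 'rV[R]_n.+1 -> R) (x : 'rV[R]_n.+1) : R :=
  enorm (\row_(i < n.+1) partial i u x).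

Definition laplacian (R : realType) (n : nat)
    (u : 'rV[R]_n.+1 -> R) (x : 'rV[R]_n.+1) : R :=
  \sum_(i < n.+1) partial i (partial i u) x.

(* Meant for open A: derivability and continuity are those of u on the whole
   space, at the points of A. *)
Definition C2_on (R : realType) (n : nat) (A : set 'rV[R]_n.+1)
    (u : 'rV[R]_n.+1 -> R) : Prop :=
  forall x, A x ->
  [/\ {for x, continuous u},
      forall i, derivable u x (delta_mx 0 i) /\
                {for x, continuous (partial i u)} &
      forall i j, derivable (partial i u) x (delta_mx 0 j) /\
                  {for x, continuous (partial j (partial i u))}].

Definition harmonic_on (R : realType) (n : nat) (A : set 'rV[R]_n.+1)
    (u : 'rV[R]_n.+1 -> R) : Prop :=
  C2_on A u /\ forall x, A x -> laplacian u x = 0.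

(* Only the values of Y on the sphere matter. *)
Definition spherical_harmonic (R : realType) (d m : nat)
    (Y : 'rV[R]_d.+1 -> R) : Prop :=
  exists p : mpoly d.+1 R,
    [/\ p \is ishomog1 m mdeg,
        harmonic_on setT (fun x : 'rV[R]_d.+1 => meval (x 0) p) &
        forall z, unit_sphere z -> Y z = meval (z 0) p].

(* x / |x|, with an arbitrary point of the sphere at the origin: there
   r ^+ m * Y (x / r) vanishes for m > 0, and Y is constant on the sphere for
   m = 0, so that solid Y m is the homogeneous harmonic polynomial. *)
Definition direction (R : realType) (d : nat) (x : 'rV[R]_d.+1) :
    'rV[R]_d.+1 :=
  if x == 0 then delta_mx 0 ord0 else (enorm x)^-1 *: x.

Definition solid (R : realType) (d m : nat) (Y : 'rV[R]_d.+1 -> R)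
    (x : 'rV[R]_d.+1) : R :=
  enorm x ^+ m * Y (direction x).

Record weight (R : realType) (w : R -> R) : Prop := Weight {
  weight_gt0 : forall r, 0 <= r < 1 -> 0 < w r;
  weight_decr : forall r s, 0 <= r -> r <= s -> s < 1 -> w s <= w r;
  weight_lim : w r @[r --> 1^'-] --> 0;
  weight_doubling : exists2 B : R, 0 < B &
    forall t, 0 < t <= 1 -> B * w (1 - t) <= w (1 - t / 2) }.

Definition growth (R : realType) (w : R -> R) (x : R) : R :=
  (w (1 - x^-1))^-1.

Definition bloch_norm (R : realType) (d : nat) (w : R -> R)
    (u : 'rV[R]_d.+1 -> R) : \bar R :=
  (`|u 0|%:E +
   ereal_sup [set (w (enorm z) * grad_norm u z)%:E | z in @unit_ball R d.+1])%E.

Definition bloch (R : realType) (d : nat) (w : R -> R)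
    (u : 'rV[R]_d.+1 -> R) : Prop :=
  harmonic_on (@unit_ball R d.+1) u /\ (bloch_norm w u < +oo)%E.

Definition subnormal (dO : measure_display) (Omega : measurableType dO)
    (R : realType) (P : probability Omega R) (X : {RV P >-> R}) : Prop :=
  forall l : R, ('M_P X l <= (expR (l ^+ 2 / 2))%:E)%E.

Definition independent_family (dO : measure_display)
    (Omega : measurableType dO) (R : realType) (P : probability Omega R)
    (I : eqType) (X : I -> {RV P >-> R}) : Prop :=
  forall (s : seq I) (E : I -> set R), uniq s ->
    (forall i, measurable (E i)) ->
    P (\bigcap_(i in [set` s]) (X i @^-1` E i)) =
    (\prod_(i <- s) P (X i @^-1` E i))%E.

Definition subnormal_sequence (dO : measure_display)
    (Omega : measurableType dO) (R : realType) (P : probability Omega R)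
    (I : eqType) (X : I -> {RV P >-> R}) : Prop :=
  independent_family X /\ forall i, subnormal (X i).

(* |a_m|^2 *)
Definition sqnorm (R : realType) (L : nat -> nat)
    (a : forall m, 'I_(L m).+1 -> R) (m : nat) : R :=
  \sum_(l < (L m).+1) `|a m l| ^+ 2.

Definition random_term (dO : measure_display) (Omega : measurableType dO)
    (R : realType) (P : probability Omega R) (d : nat) (L : nat -> nat)
    (Y : forall m, 'I_(L m).+1 -> 'rV[R]_d.+1 -> R)
    (a : forall m, 'I_(L m).+1 -> R)
    (xi : {m : nat & 'I_(L m).+1} -> {RV P >-> R})
    (omega : Omega) (x : 'rV[R]_d.+1) (m : nat) : R :=
  \sum_(l < (L m).+1)
    a m l * xi (Tagged (fun m => 'I_(L m).+1) l) omega * solid m (Y m l) x.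

Definition random_series (dO : measure_display) (Omega : measurableType dO)
    (R : realType) (P : probability Omega R) (d : nat) (L : nat -> nat)
    (Y : forall m, 'I_(L m).+1 -> 'rV[R]_d.+1 -> R)
    (a : forall m, 'I_(L m).+1 -> R)
    (xi : {m : nat & 'I_(L m).+1} -> {RV P >-> R})
    (omega : Omega) (x : 'rV[R]_d.+1) : R :=
  limn (series (random_term Y a xi omega x)).

(* Main.v *)
(* Fix a block n_(k-1) < m <= n_k. A partial derivative, at a point z of the sphere, of a partial sum of the
   block is a linear combination of the xi_ml; by Bernstein's inequality a homogeneous polynomial of degree m
   bounded by 1 on the sphere has gradient O(m) there, so the squares of the coefficients add up to
   O(V_k), V_k = sum m^2 |a_m|^2. Independence and subnormality give Gaussian tails. Bernstein's inequality
   on great circles also shows that a polynomial of degree n_k is controlled on the sphere by a net of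
   O(n_k^(d+1)) points, so a union bound costs only a factor log n_k in the variance, and by Borel-Cantelli
   the block derivatives are almost surely O(sqrt (V_k log n_k)) on the sphere for all large k. By the
   hypotheses the partial sums, up to degree N, of the derivatives of u are then O(g(N)) on the sphere.
   Abel summation in the radius and the doubling property turn this into |grad u(x)| = O(g(1 / (1 - |x|))),
   which is O(1 / w(|x|)).

   Bernstein's inequality follows from M. Riesz's interpolation formula, which expresses T'(th) as a
   combination of the 2N values T(th + t_j), t_j = (2j + 1) pi / 2N. *)

Require Import Defs.
From HB Require Import structures.
From mathcomp Require Import all_boot all_order all_algebra.
From mathcomp Require Import all_classical all_reals all_analysis.
From mathcomp Require Import measurable_realfun.
From mathcomp Require Import ring lra zify.
From mathcomp Require Import -(notations) mpoly.

Set Implicit Arguments.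
Unset Strict Implicit.
Unset Printing Implicit Defensive.

Import Order.TTheory GRing.Theory Num.Theory.
Import numFieldNormedType.Exports.

Local Open Scope classical_set_scope.
Local Open Scope ring_scope.

(** * Bernstein's inequality for trigonometric polynomials *)

(** Probability is confined to finite unions of events: the bad event of a block is a union over
    coordinates, truncation points and net points, and off it the bound on the whole sphere is
    deterministic. No supremum over the sphere has to be measurable. The truncations at every [N]
    inside a block are included because Abel summation needs all partial sums, not only those that
    end at some [n_k]; they cost one more factor of order [n_k]. The Gaussian exponent
    [(d + 4) log n_k] then beats the [O(n_k^(d+2))] events by [n_k^(-2)], which is summable since
    [n_k > k]. Control starts at a random index; all earlier terms go into a random constant, which
    is absorbed because [g >= g(1) > 0]. The same partial-sum bounds serve a second time: doubling
    makes [g] grow at most polynomially, so the homogeneous terms do too on the sphere. The series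
    and its termwise derivatives are therefore dominated by convergent numerical series on smaller
    balls, which gives convergence and harmonicity of [u]. *)

Definition riesz_node (R : realType) (N j : nat) : R :=
  j.*2.+1%:R * (pi / N.*2%:R).

(** The nodes [t_j] are the zeros of [cos (N t)] in [(0, 2 pi)]. The sign [(-1)^j] of the weight is
    the value of [sin (N t_j)]. *)
Definition riesz_weight (R : realType) (N j : nat) : R :=
  (-1) ^+ j / (N.*2.*2%:R * sin (riesz_node R N j / 2) ^+ 2).

Lemma sin_natpi (R : realType) (k : nat) : sin (k%:R * pi) = 0 :> R.
Proof.
elim: k => [|k IH]; first by rewrite mul0r sin0.
by rewrite -natr1 mulrDl mul1r sinDpi IH oppr0.
Qed.

Lemma cos_natpi (R : realType) (k : nat) : cos (k%:R * pi) = (-1) ^+ k :> R.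
Proof.
elim: k => [|k IH]; first by rewrite mul0r cos0.
by rewrite -natr1 mulrDl mul1r cosDpi IH exprS mulN1r.
Qed.

Lemma riesz_nodeN (R : realType) (N j : nat) : (0 < N)%N ->
  N%:R * riesz_node R N j = j%:R * pi + pi / 2.
Proof.
move=> N0; rewrite /riesz_node -mul2n -addn1 natrD natrM -mul2n natrM.
have : N%:R != 0 :> R by rewrite pnatr_eq0 -lt0n.
by move=> h; field.
Qed.

Lemma sin_riesz_nodeN (R : realType) (N j : nat) : (0 < N)%N ->
  sin (N%:R * riesz_node R N j) = (-1) ^+ j.
Proof. by move=> N0; rewrite riesz_nodeN // sinDpihalf cos_natpi. Qed.

Lemma cos_riesz_nodeN (R : realType) (N j : nat) : (0 < N)%N ->
  cos (N%:R * riesz_node R N j) = 0.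
Proof. by move=> N0; rewrite riesz_nodeN // cosDpihalf sin_natpi oppr0. Qed.

Lemma sin_riesz_half_gt0 (R : realType) (N j : nat) : (j < N.*2)%N ->
  0 < sin (riesz_node R N j / 2).
Proof.
move=> jN; have N0 : 0 < N.*2%:R :> R by rewrite ltr0n; lia.
have pi0 := pi_gt0 R.
have -> : riesz_node R N j / 2 = pi * (j.*2.+1%:R / N.*2.*2%:R).
  by rewrite /riesz_node -(mul2n N.*2) natrM; field; rewrite lt0r_neq0.
apply: sin_gt0_pi; rewrite pmulr_rgt0// gtr_pMr// divr_gt0 ?ltr0n//=; last lia.
by rewrite ltr_pdivrMr ?ltr0n ?mul1r ?ltr_nat; lia.
Qed.

(* Multiplying by [2 cos (k pi / 2N)] makes the sum telescope. *)
Lemma riesz_orthogonal (R : realType) (N k : nat) : (k < N)%N ->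
  \sum_(j < N.*2) (-1) ^+ j * sin (k%:R * riesz_node R N j) = 0.
Proof.
move=> kN; pose al : R := k%:R * (pi / N.*2%:R).
have N0 : 0 < N%:R :> R by rewrite ltr0n; lia.
have pi0 := pi_gt0 R.
have c0 : 0 < cos al.
  have -> : al = pi / 2 * (k%:R / N%:R).
    by rewrite /al -mul2n natrM; field; rewrite lt0r_neq0.
  have kN0 : 0 <= k%:R / N%:R :> R by rewrite divr_ge0.
  have p20 : 0 < pi / 2 :> R by rewrite divr_gt0.
  apply: cos_gt0_pihalf; rewrite gtr_pMr// ltr_pdivrMr// mul1r ltr_nat kN andbT.
  by apply: lt_le_trans (mulr_ge0 (ltW p20) kN0); rewrite oppr_lt0.
apply: (mulIf (lt0r_neq0 c0)); rewrite mul0r.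
apply: (mulIf (lt0r_neq0 (ltr0Sn R 1))); rewrite mul0r -mulrA big_distrl /=.
pose S j : R := (-1) ^+ j * sin (j%:R * al *+ 2).
transitivity (\sum_(j < N.*2) (- (S j.+1 - S j))).
  apply: eq_bigr => -[j jN] _ /=; rewrite /S exprS -mulrA.
  have -> : k%:R * riesz_node R N j = j%:R * al *+ 2 + al.
    by rewrite /riesz_node /al -mul2n -addn1 natrD natrM -!mul2n !natrM; ring.
  have -> : j.+1%:R * al *+ 2 = (j%:R * al *+ 2 + al) + al.
    by rewrite -natr1; ring.
  rewrite [sin (_ + al + al)]sinD.
  have -> : sin (j%:R * al *+ 2) = sin (j%:R * al *+ 2 + al - al) by rewrite addrK.
  by rewrite sinB; ring.
rewrite sumrN; rewrite -(big_mkord xpredT (fun j => S j.+1 - S j)) telescope_sumr// /S.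
rewrite mul0r mul0rn sin0 mulr0 subr0.
have -> : N.*2%:R * al *+ 2 = k.*2%:R * pi.
  by rewrite /al -!mul2n !natrM; field; rewrite lt0r_neq0.
by rewrite sin_natpi mulr0 oppr0.
Qed.

(* [s k = sum_j c_j sin (k t_j)] satisfies [s 0 = 0], has second differences [0]
   below [N] and [- 2] at [N], and is symmetric about [N]; hence [s k = k]. *)
Lemma riesz_sum_sin (R : realType) (N k : nat) : (0 < N)%N -> (k <= N)%N ->
  \sum_(j < N.*2) riesz_weight R N j * sin (k%:R * riesz_node R N j) = k%:R.
Proof.
move=> N0 kN; pose s k : R := \sum_(j < N.*2) riesz_weight R N j * sin (k%:R * riesz_node R N j).
rewrite -/(s k).
have Nr0 : 0 < N%:R :> R by rewrite ltr0n.
have s0 : s 0%N = 0 by apply: big1 => j _; rewrite mul0r sin0 mulr0.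
have s2 i : s i.+2 - s i.+1 *+ 2 + s i =
    - N%:R^-1 * \sum_(j < N.*2) (-1) ^+ j * sin (i.+1%:R * riesz_node R N j).
  rewrite /s -sumrMnl -sumrB -big_split /= mulr_sumr; apply: eq_bigr => -[j jN] _ /=.
  set t := riesz_node R N j; pose y := i.+1%:R * t.
  have -> : i.+2%:R * t = y + t by rewrite /y -(natr1 i.+1); ring.
  have -> : i%:R * t = y - t by rewrite /y -(natr1 i); ring.
  rewrite -/y sinD sinB /riesz_weight -/t.
  have h0 : sin (t / 2) != 0 by rewrite lt0r_neq0// sin_riesz_half_gt0.
  (* [sin (y + t) - 2 sin y + sin (y - t) = - 4 sin^2 (t / 2) sin y], which cancels the denominator
     of the weight. *)
  have -> : cos t = 1 - sin (t / 2) ^+ 2 *+ 2.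
    have -> : t = (t / 2) *+ 2 by field.
    rewrite cos_mulr2n cos2sin2.
    have -> : t / 2 *+ 2 / 2 = t / 2 by field.
    ring.
  by rewrite -!mul2n !natrM; field; rewrite h0 lt0r_neq0.
have sN1 : s N.+1 = s N.-1.
  rewrite /s; apply: eq_bigr => j _; congr (_ * _).
  set t := riesz_node R N j.
  have -> : N.+1%:R * t = N%:R * t + t by rewrite -natr1; ring.
  have -> : N.-1%:R * t = N%:R * t - t by rewrite -{2}(prednK N0) -natr1; ring.
  by rewrite sinD sinB cos_riesz_nodeN// !mul0r addr0 subr0.
have slin i : (i < N)%N -> s i.+1 - s i = s 1%N.
  elim: i => [|i IH] iN; first by rewrite s0 subr0.
  have := s2 i; rewrite riesz_orthogonal// mulr0 => /eqP.
  rewrite mulr2n opprD !addrA => /eqP h.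
  by rewrite -(IH (ltnW iN)); apply/eqP; rewrite -subr_eq0 -h; apply/eqP; ring.
have s1 : s 1%N = 1.
  have := s2 N.-1; rewrite prednK// sN1.
  under eq_bigr => j _ do rewrite sin_riesz_nodeN// -exprMn mulrNN mulr1 expr1n.
  rewrite sumr_const card_ord.
  have -> : - N%:R^-1 * N.*2%:R = -2 :> R by rewrite -mul2n natrM; field; rewrite lt0r_neq0.
  have := slin N.-1; rewrite prednK// => /(_ (leqnn _)) <- h; lra.
elim: k kN => [|k IH] kN //.
by have := slin k kN; rewrite s1 IH 1?ltnW// -natr1 => h; lra.
Qed.

(** Reversing the order of the nodes replaces [t_j] by [2 pi - t_j]: [cos (k t_j)] and
    [sin^2 (t_j / 2)] are unchanged while [(-1)^j] flips, so the sum equals its opposite. *)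
Lemma riesz_sum_cos (R : realType) (N k : nat) : (0 < N)%N ->
  \sum_(j < N.*2) riesz_weight R N j * cos (k%:R * riesz_node R N j) = 0.
Proof.
move=> N0; set S := \sum_(j < _) _.
have Nr0 : 0 < N%:R :> R by rewrite ltr0n.
suff : S = - S by lra.
rewrite {1}/S (reindex_inj rev_ord_inj) /= /S -sumrN; apply: eq_bigr => -[j jN] _ /=.
have tE : riesz_node R N (N.*2 - j.+1) = pi *+ 2 - riesz_node R N j.
  rewrite /riesz_node -mul2n -addn1 natrD natrM natrB//.
  rewrite -(mul2n j) -(addn1 (2 * j)) natrD natrM -natr1 -mul2n natrM.
  by field; rewrite lt0r_neq0.
set t := riesz_node R N j in tE *; rewrite tE.
have -> : cos (k%:R * (pi *+ 2 - t)) = cos (k%:R * t).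
  have -> : k%:R * (pi *+ 2 - t) = k.*2%:R * pi - k%:R * t.
    by rewrite -mul2n natrM; ring.
  by rewrite cosB sin_natpi cos_natpi mul0r addr0 -mul2n exprM expr2 mulrNN mulr1 expr1n mul1r.
rewrite -mulNr; congr (_ * _); rewrite /riesz_weight.
rewrite tE.
have -> : sin ((pi *+ 2 - t) / 2) = sin (t / 2).
  have -> : (pi *+ 2 - t) / 2 = - (t / 2) + pi by field.
  by rewrite sinDpi sinN opprK.
rewrite -mulNr; congr (_ / _); rewrite -signr_odd oddB// odd_double /= -(signr_odd _ j).
by case: (odd j) => /=; rewrite ?expr0 ?expr1 ?opprK.
Qed.

(** Since [sin (N t_j)] is the sign of the weight, the sum of absolute values is the sine sum at
    [k = N]. This value is the constant in Bernstein's inequality. *)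
Lemma riesz_sum_norm (R : realType) (N : nat) : (0 < N)%N ->
  \sum_(j < N.*2) `|riesz_weight R N j| = N%:R.
Proof.
move=> N0; rewrite -(riesz_sum_sin R N0 (leqnn N)); apply: eq_bigr => j _.
rewrite sin_riesz_nodeN// /riesz_weight normrM normr_sign mul1r ger0_norm.
  by rewrite [RHS]mulrAC -expr2 sqrr_sign mul1r.
by rewrite invr_ge0 mulr_ge0 ?ler0n ?sqr_ge0.
Qed.

(* Real trigonometric polynomials of degree at most [N], the terms [(c, k, phi)]
   standing for [c cos (k th + phi)]. *)
Definition trigpoly (R : realType) (N : nat) (T : R -> R) : Prop :=
  exists2 s : seq (R * nat * R), all (fun z => z.1.2 <= N)%N s &
    forall th, T th = \sum_(z <- s) z.1.1 * cos (z.1.2%:R * th + z.2).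

Lemma trigpolyW (R : realType) (N M : nat) (T : R -> R) : (N <= M)%N ->
  trigpoly N T -> trigpoly M T.
Proof.
by move=> NM [s sN Ts]; exists s => //; apply: sub_all sN => z /leq_trans; apply.
Qed.

Lemma trigpolyD (R : realType) (N : nat) (T U : R -> R) :
  trigpoly N T -> trigpoly N U -> trigpoly N (fun th => T th + U th).
Proof.
move=> [s sN Ts] [r rN Ur]; exists (s ++ r); first by rewrite all_cat sN.
by move=> th; rewrite big_cat Ts Ur.
Qed.

Lemma trigpolyZ (R : realType) (N : nat) (c : R) (T : R -> R) :
  trigpoly N T -> trigpoly N (fun th => c * T th).
Proof.
move=> [s sN Ts]; exists [seq ((c * z.1.1, z.1.2), z.2) | z <- s].
  by rewrite all_map.
by move=> th; rewrite big_map Ts mulr_sumr; apply: eq_bigr => z _; rewrite mulrA.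
Qed.

Lemma trigpoly_cst (R : realType) (c : R) : trigpoly 0 (fun _ : R => c).
Proof.
by exists [:: (c, 0%N, 0)] => // th; rewrite big_seq1 /= mul0r addr0 cos0 mulr1.
Qed.

Lemma trigpoly_sum (R : realType) (N : nat) (I : eqType) (s : seq I) (T : I -> R -> R) :
  (forall i, i \in s -> trigpoly N (T i)) -> trigpoly N (fun th => \sum_(i <- s) T i th).
Proof.
elim: s => [_|i s IH h].
  by under eq_fun do rewrite big_nil; exact: trigpolyW (trigpoly_cst 0).
under eq_fun do rewrite big_cons; apply: trigpolyD; first by apply: h; rewrite mem_head.
by apply: IH => j js; apply: h; rewrite inE js orbT.
Qed.

Lemma trigpoly_mulcos (R : realType) (N : nat) (T : R -> R) (psi : R) :
  trigpoly N T -> trigpoly N.+1 (fun th => cos (th + psi) * T th).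
Proof.
move=> [s sN Ts]; under eq_fun do rewrite Ts mulr_sumr.
apply: trigpoly_sum => -[[c k] phi] /(allP sN) /= kN.
have h (x y : R) : cos x * cos y = cos (y + x) / 2 + cos (y - x) / 2.
  by rewrite cosD cosB; field.
have -> : (fun th => cos (th + psi) * (c * cos (k%:R * th + phi))) =
  (fun th => c / 2 * cos (k.+1%:R * th + (phi + psi)) +
     c / 2 * cos (k%:R * th + phi - (th + psi))).
  apply/funext => th; rewrite mulrCA h.
  have -> : k%:R * th + phi + (th + psi) = k.+1%:R * th + (phi + psi).
    by rewrite -natr1; ring.
  by field.
apply: trigpolyD; first by
  exists [:: (c / 2, k.+1, phi + psi)]; [rewrite /= andbT|move=> th; rewrite big_seq1].
(* For [k = 0] the difference frequency is [-1]; evenness of the cosine turns it into [1]. *)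
case: k kN => [|k] kN.
  exists [:: (c / 2, 1%N, psi - phi)] => // th; rewrite big_seq1 /= -cosN.
  by congr (_ * cos _); ring.
exists [:: (c / 2, k, phi - psi)] => [|th]; first by rewrite /= andbT; lia.
by rewrite big_seq1 /=; congr (_ * cos _); rewrite -natr1; ring.
Qed.

(** The coordinates of a great circle have the form of the first factor, so along it each variable
    of a monomial raises the degree by one. *)
Lemma trigpoly_mul1 (R : realType) (N : nat) (T : R -> R) (a b : R) :
  trigpoly N T -> trigpoly N.+1 (fun th => (cos th * a + sin th * b) * T th).
Proof.
move=> hT.
have -> : (fun th => (cos th * a + sin th * b) * T th) =
   (fun th => a * (cos (th + 0) * T th) + b * (cos (th + - (pi / 2)) * T th)).
  by apply/funext => th; rewrite cosBpihalf addr0; ring.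
by apply: trigpolyD; apply: trigpolyZ; apply: trigpoly_mulcos.
Qed.

(** By linearity one term [cos (k th + phi) = cos y] is enough. The addition formula for
    [cos (y + k t_j)] leaves the two weighted sums above: [0] against [cos y] and [k] against
    [sin y]. *)
Lemma riesz_interpolation (R : realType) (N : nat) (T : R -> R) (th : R) :
  (0 < N)%N -> trigpoly N T ->
  is_derive th 1 T (\sum_(j < N.*2) riesz_weight R N j * T (th + riesz_node R N j)).
Proof.
move=> N0 [s sN Ts].
have -> : T = fun th => \sum_(z <- s) z.1.1 * cos (z.1.2%:R * th + z.2).
  by apply/funext.
under eq_bigr do rewrite mulr_sumr.
rewrite exchange_big /=.
elim: s sN {Ts} => [_|[[c k] phi] s IH /= /andP[kN sN]].
  under eq_fun do rewrite big_nil; rewrite big_nil; exact: is_derive_cst.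
under eq_fun do rewrite big_cons; rewrite big_cons /=.
apply: is_deriveD; last exact: IH.
apply: is_derive_eq.
set y := k%:R * th + phi.
transitivity (c * (- sin y * (k%:R * 1 + 0) : R)); first by [].
transitivity (c * (cos y * \sum_(j < N.*2) riesz_weight R N j * cos (k%:R * riesz_node R N j)
   - sin y * \sum_(j < N.*2) riesz_weight R N j * sin (k%:R * riesz_node R N j))).
  by rewrite riesz_sum_cos// riesz_sum_sin// mulr1 addr0 mulr0 sub0r mulNr.
rewrite 2!mulr_sumr -sumrB mulr_sumr; apply: eq_bigr => j _.
have -> : k%:R * (th + riesz_node R N j) + phi = y + k%:R * riesz_node R N j by rewrite /y; ring.
by rewrite (cosD y); ring.
Qed.

Lemma trigpoly_bernstein (R : realType) (N : nat) (T : R -> R) (M th : R) :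
  trigpoly N T -> (forall t, `|T t| <= M) ->
  derivable T th 1 /\ `|'D_1 T th| <= N%:R * M.
Proof.
(* For [N = 0] there are no nodes, but all frequencies vanish and [T] is constant. *)
case: N => [[s sN Ts] TM|N hT TM].
  have -> : T = cst (T 0).
    apply/funext => t; rewrite !Ts; apply: eq_big_seq => z /(allP sN) /=.
    by rewrite leqn0 => /eqP ->; rewrite !mul0r.
  by split; [exact: derivable_cst|rewrite derive_cst normr0 mul0r].
have [d ->] := riesz_interpolation th (ltn0Sn N) hT; split => //.
apply: le_trans (ler_norm_sum _ _ _) _.
rewrite -(riesz_sum_norm R (ltn0Sn N)) mulr_suml; apply: ler_sum => j _.
by rewrite normrM ler_wpM2l.
Qed.

Lemma trigpoly_lipschitz (R : realType) (N : nat) (T : R -> R) (M th : R) :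
  trigpoly N T -> (forall t, `|T t| <= M) -> 0 <= th ->
  `|T th - T 0| <= N%:R * M * th.
Proof.
move=> hT TM; rewrite le_eqVlt => /predU1P[<-|th0]; first by rewrite subrr normr0 mulr0.
have hd (t : R) : is_derive t 1 T ('D_1 T t).
  by apply: derivableP; case: (trigpoly_bernstein t hT TM).
have ct : {within `[0, th], continuous T}.
  by apply: derivable_within_continuous => t _; have [] := trigpoly_bernstein t hT TM.
have [c _ ->] := MVT th0 (fun t _ => hd t) ct.
rewrite subr0 normrM (ger0_norm (ltW th0)) ler_wpM2r ?(ltW th0)//.
exact: (trigpoly_bernstein c hT TM).2.
Qed.

(** * Polynomials on the Euclidean sphere *)

(** Induction along the ring operations instead of monomials, so that differentiability and
    continuity reduce to the rules for sums and products. *)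
Lemma mpoly_ring_ind (R : realType) (n : nat) (Q : mpoly n R -> Prop) :
  (forall c, Q (mpolyC n c)) -> (forall i, Q (mpolyX R (mnm1 i))) ->
  (forall p q, Q p -> Q q -> Q (p + q)) ->
  (forall p q, Q p -> Q q -> Q (p * q)) -> forall p, Q p.
Proof.
move=> QC QX QD QM; elim/mpolyind => [|c m p _ _ Qp].
  by rewrite -(mpolyC0 n); exact: QC.
apply: (QD) => //; rewrite -mul_mpolyC; apply: (QM) => //.
rewrite mpolyXE_id; apply: (big_ind Q) => [||i _]; first by rewrite -(mpolyC1 n); exact: QC.
  exact: QM.
elim: (m i) => [|k IH]; first by rewrite expr0 -(mpolyC1 n); exact: QC.
by rewrite exprS; exact: QM.
Qed.

(** The chain rule, for an arbitrary substitution [g]: it serves for partial derivatives, for great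
    circles and for rays from the origin. *)
Lemma is_derive_meval (R : realType) (V : normedModType R) (n : nat)
    (p : mpoly n R) (g : V -> 'I_n -> R) (dg : 'I_n -> R) (x v : V) :
  (forall i, is_derive x v (fun y => g y i) (dg i)) ->
  is_derive x v (fun y => meval (g y) p) (\sum_i dg i * meval (g x) (mderiv i p)).
Proof.
move=> hg; elim/mpoly_ring_ind: p => [c|i|p q hp hq|p q hp hq].
- under eq_fun do rewrite mevalC.
  rewrite big1 => [|i _]; last by rewrite mderivC meval0 mulr0.
  exact: is_derive_cst.
- under eq_fun do rewrite mevalXU.
  rewrite (bigD1 i)//= big1 => [|j ji]; rewrite mderivX.
    rewrite mnm1E eqxx mevalZ mul1r mevalX big1 ?mulr1 ?addr0// => k _.
    by rewrite mnmBE subnn expr0.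
  by rewrite mnm1E eq_sym (negbTE ji) scale0r meval0 mulr0.
- under eq_fun do rewrite mevalD.
  under eq_bigr do rewrite mderivD mevalD mulrDr.
  by rewrite big_split; exact: is_deriveD.
- under eq_fun do rewrite mevalM.
  apply: is_derive_eq; rewrite /GRing.scale /= 2!mulr_sumr -big_split /=.
  by apply: eq_bigr => i _; rewrite mderivM mevalD !mevalM; ring.
Qed.

Lemma is_derive_coord (R : realType) (n : nat) (x v : 'rV[R]_n) (i : 'I_n) :
  is_derive x v (fun y : 'rV[R]_n => y 0 i) (v 0 i).
Proof.
have d : differentiable (fun y : 'rV[R]_n => y 0 i : R) x by exact: differentiable_coord.
split; first exact: diff_derivable.
rewrite /derive; apply: cvg_lim => //.
apply: cvg_near_cst.
near=> h; have h0 : h != 0 by near: h; exact: nbhs_dnbhs_neq.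
by rewrite /= !mxE addrK /GRing.scale /= mulKf.
Unshelve. all: by end_near. Qed.

Lemma is_derive_meval_partial (R : realType) (n : nat) (p : mpoly n.+1 R)
    (i : 'I_n.+1) (x : 'rV[R]_n.+1) :
  is_derive x (delta_mx 0 i) (fun y : 'rV[R]_n.+1 => meval (y 0) p) (meval (x 0) (mderiv i p)).
Proof.
have := is_derive_meval p (fun j => is_derive_coord x (delta_mx 0 i) j).
rewrite (bigD1 i)//= big1 ?addr0; last first.
  by move=> j ji; rewrite mxE eqxx (negbTE ji) mul0r.
by rewrite mxE !eqxx mul1r.
Qed.

Lemma partial_meval (R : realType) (n : nat) (p : mpoly n.+1 R) (i : 'I_n.+1) :
  partial i (fun y : 'rV[R]_n.+1 => meval (y 0) p) =
  fun y => meval (y 0) (mderiv i p).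
Proof.
by apply/funext => x; have [_ h] := is_derive_meval_partial p i x.
Qed.

Lemma continuous_meval (R : realType) (n : nat) (p : mpoly n R) :
  continuous (fun y : 'rV[R]_n => meval (y 0) p).
Proof.
elim/mpoly_ring_ind: p => [c|i|p q hp hq|p q hp hq] x.
- by under eq_fun do rewrite mevalC; exact: cst_continuous.
- by under eq_fun do rewrite mevalXU; exact: coord_continuous.
- under eq_fun do rewrite mevalD; exact: (continuousD (hp x) (hq x)).
- under eq_fun do rewrite mevalM; exact: (continuousM (hp x) (hq x)).
Qed.

Lemma meval_scale (R : realType) (n m : nat) (p : mpoly n R) (c : R) (v : 'I_n -> R) :
  p \is ishomog1 m mdeg -> meval (fun i => c * v i) p = c ^+ m * meval v p.
Proof.
move=> /dhomogP hp; rewrite !mevalE mulr_sumr; apply: eq_big_seq => mm /hp <-.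
rewrite mulrCA; congr (_ * _).
under eq_bigr do rewrite exprMn.
by rewrite big_split /= prodrXr mdegE.
Qed.

(** Truncated blocks mix degrees; the great circle and net estimates are therefore stated for
    bounded degree instead of homogeneity. *)
Definition mdeg_le (R : realType) (n N : nat) (p : mpoly n R) : Prop :=
  forall m, (N < mdeg m)%N -> mcoeff m p = 0.

Lemma dhomog_mdeg_le (R : realType) (n m N : nat) (p : mpoly n R) : (m <= N)%N ->
  p \is ishomog1 m mdeg -> mdeg_le N p.
Proof.
move=> mN hp mm Nm; apply: dhomog_nemf_coeff hp _.
by rewrite gtn_eqF// (leq_ltn_trans mN).
Qed.

Lemma mdeg_le_sum (R : realType) (n N : nat) (I : Type) (s : seq I) (P : pred I)
    (p : I -> mpoly n R) :
  (forall i, P i -> mdeg_le N (p i)) -> mdeg_le N (\sum_(i <- s | P i) p i).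
Proof.
by move=> hp m Nm; rewrite raddf_sum; apply: big1 => i Pi; exact: hp.
Qed.

Lemma dhomog_mderiv (R : realType) (n m : nat) (p : mpoly n R) (i : 'I_n) :
  p \is ishomog1 m mdeg -> mderiv i p \is ishomog1 m.-1 mdeg.
Proof.
move=> hp; apply/dhomogP => mm; rewrite mcoeff_msupp mcoeff_mderiv => h.
have : mcoeff (mnm_add mm (mnm1 i)) p != 0 by apply: contra_neq h => ->; rewrite mul0rn.
by rewrite -mcoeff_msupp => /(dhomog_mf hp) <-; rewrite /= mdegD mdeg1 addn1.
Qed.

Lemma trigpoly_meval (R : realType) (n N : nat) (p : mpoly n R) (x y : 'I_n -> R) :
  mdeg_le N p -> trigpoly N (fun th => meval (fun i => cos th * x i + sin th * y i) p).
Proof.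
move=> hp; under eq_fun do rewrite mevalE.
apply: trigpoly_sum => m; rewrite mcoeff_msupp => cm; apply: trigpolyZ.
apply: (@trigpolyW _ (mdeg m)).
  by rewrite leqNgt; apply: contra_neqN cm; exact: hp.
rewrite mdegE; elim: (index_enum _) => [|i s IH].
  by rewrite big_nil; under eq_fun do rewrite big_nil; exact: trigpoly_cst.
rewrite big_cons; under [X in trigpoly _ X]eq_fun do rewrite big_cons.
elim: (m i) => [|k IHk].
  by under [X in trigpoly _ X]eq_fun do rewrite expr0 mul1r.
by under [X in trigpoly _ X]eq_fun do rewrite exprS -mulrA; exact: trigpoly_mul1.
Qed.

Lemma unit_sphereE (R : realType) (n : nat) (x : 'rV[R]_n) :
  unit_sphere x <-> \sum_i x 0 i ^+ 2 = 1.
Proof.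
rewrite /unit_sphere /enorm /=; split => [h|->]; last by rewrite sqrtr1.
rewrite -[LHS]sqr_sqrtr ?h ?expr1n//.
by apply: sumr_ge0 => i _; exact: sqr_ge0.
Qed.

Lemma unit_sphere_coord (R : realType) (n : nat) (x : 'rV[R]_n) (i : 'I_n) :
  unit_sphere x -> `|x 0 i| <= 1.
Proof.
move=> /unit_sphereE h; rewrite -(@ler_pXn2r _ 2) ?nnegrE// expr1n real_normK ?num_real//.
by rewrite -h (bigD1 i)//= lerDl sumr_ge0// => j _; rewrite sqr_ge0.
Qed.

Lemma meval_great_circle_le (R : realType) (n : nat) (p : mpoly n R) (x v : 'rV[R]_n) (M : R) (th : R) :
  (forall z, unit_sphere z -> `|meval (z 0) p| <= M) ->
  unit_sphere x -> unit_sphere v -> \sum_i x 0 i * v 0 i = 0 ->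
  `|meval (fun i => cos th * x 0 i + sin th * v 0 i) p| <= M.
Proof.
move=> pM /unit_sphereE hx /unit_sphereE hv xv.
have -> : (fun i => cos th * x 0 i + sin th * v 0 i) = (cos th *: x + sin th *: v) 0.
  by apply/funext => i; rewrite !mxE.
apply: pM; apply/unit_sphereE; transitivity (\sum_i (cos th ^+ 2 * x 0 i ^+ 2 +
   (cos th * sin th *+ 2) * (x 0 i * v 0 i) + sin th ^+ 2 * v 0 i ^+ 2)).
  by apply: eq_bigr => i _; rewrite !mxE; ring.
rewrite !big_split /= -!mulr_sumr hx hv xv !mulr1 mulr0 addr0.
exact: cos2Dsin2.
Qed.

(** The left side is the derivative at [th = 0] of [p] along the great circle leaving [x] in the
    direction [v], where [p] is a trigonometric polynomial of degree at most [N] bounded by [M]. *)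
Lemma meval_tangent_le (R : realType) (n N : nat) (p : mpoly n R) (x v : 'rV[R]_n) (M : R) :
  mdeg_le N p -> (forall z, unit_sphere z -> `|meval (z 0) p| <= M) ->
  unit_sphere x -> unit_sphere v -> \sum_i x 0 i * v 0 i = 0 ->
  `|\sum_i v 0 i * meval (x 0) (mderiv i p)| <= N%:R * M.
Proof.
move=> hN pM hx hv xv.
have hT := trigpoly_meval (x 0) (v 0) hN.
have [_] := trigpoly_bernstein 0 hT (fun t => meval_great_circle_le t pM hx hv xv).
congr (`|_| <= _).
have hd i : is_derive (0 : R) (1 : R) (fun th => cos th * x 0 i + sin th * v 0 i) (v 0 i).
  have h1 : is_derive (0 : R) (1 : R) (fun th => cos th * x 0 i) (- sin 0 * x 0 i).
    by apply: is_derive_eq; rewrite scaler0 add0r /GRing.scale /= mulrC.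
  have h2 : is_derive (0 : R) (1 : R) (fun th => sin th * v 0 i) (cos 0 * v 0 i).
    by apply: is_derive_eq; rewrite scaler0 add0r /GRing.scale /= mulrC.
  have := is_deriveD h1 h2; rewrite sin0 cos0 oppr0 mul0r add0r mul1r.
  exact.
have [_ ->] := is_derive_meval p hd.
apply: eq_bigr => i _; congr (_ * meval _ _).
by apply/funext => j; rewrite cos0 sin0 mul1r mul0r addr0.
Qed.

(** Differentiate [p (c x) = c^m p (x)] at [c = 1]. *)
Lemma euler_homog (R : realType) (n m : nat) (p : mpoly n R) (x : 'I_n -> R) :
  p \is ishomog1 m mdeg -> \sum_i x i * meval x (mderiv i p) = m%:R * meval x p.
Proof.
move=> hp.
have hd i : is_derive (1 : R) (1 : R) (fun c => c * x i) (x i).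
  by apply: is_derive_eq; rewrite scaler0 add0r /GRing.scale /= mulr1.
have [_] := is_derive_meval p hd.
under eq_fun do rewrite (meval_scale _ _ hp).
have [_ ->] : is_derive (1 : R) (1 : R) (fun c => c ^+ m * meval x p) (m%:R * meval x p).
  have h : is_derive (1 : R) (1 : R) (fun c => c ^+ m) m%:R.
    split; first exact: exprn_derivable.
    by rewrite -derive1E exp_derive1 expr1n /GRing.scale /= mulr1.
  have hc : is_derive (1 : R) (1 : R) (cst (meval x p)) 0 by exact: is_derive_cst.
  have := is_deriveM h hc; rewrite scaler0 add0r /GRing.scale /= [meval x p * _]mulrC; exact.
move=> ->; apply: eq_bigr => i _; congr (_ * meval _ _).
by apply/funext => j; rewrite mul1r.
Qed.

(* [e_i = x_i x + w] with [w] tangent to the sphere at [x] and [|w| <= 1]. *)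
Lemma homog_partial_le (R : realType) (n m : nat) (p : mpoly n R) (M : R)
    (i : 'I_n) (x : 'rV[R]_n) :
  p \is ishomog1 m mdeg -> (forall z, unit_sphere z -> `|meval (z 0) p| <= M) ->
  unit_sphere x -> `|meval (x 0) (mderiv i p)| <= m%:R * M *+ 2.
Proof.
move=> hp pM hx; have /unit_sphereE hx1 := hx.
have M0 : 0 <= M := le_trans (normr_ge0 _) (pM x hx).
have mM0 : 0 <= m%:R * M by rewrite mulr_ge0.
pose w : 'rV[R]_n := delta_mx 0 i - x 0 i *: x.
have wE j : w 0 j = (j == i)%:R - x 0 i * x 0 j by rewrite !mxE eqxx.
have e1 (f : 'I_n -> R) : \sum_j (j == i)%:R * f j = f i.
  rewrite (bigD1 i)//= big1 ?addr0 ?eqxx ?mul1r// => j ji.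
  by rewrite (negbTE ji) mul0r.
have xw : \sum_j x 0 j * w 0 j = 0.
  transitivity (\sum_j ((j == i)%:R * x 0 j - x 0 i * (x 0 j ^+ 2))).
    by apply: eq_bigr => j _; rewrite wE; ring.
  by rewrite sumrB e1 -mulr_sumr hx1 mulr1 subrr.
have ww : \sum_j w 0 j ^+ 2 = 1 - x 0 i ^+ 2.
  transitivity (\sum_j ((j == i)%:R * w 0 j - x 0 i * (x 0 j * w 0 j))).
    by apply: eq_bigr => j _; rewrite expr2 {1}wE; ring.
  by rewrite sumrB e1 -mulr_sumr xw wE eqxx /=; ring.
have -> : meval (x 0) (mderiv i p) = x 0 i * (\sum_j x 0 j * meval (x 0) (mderiv j p)) +
    \sum_j w 0 j * meval (x 0) (mderiv j p).
  rewrite mulr_sumr -big_split /= -(e1 (fun j => meval (x 0) (mderiv j p))).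
  by apply: eq_bigr => j _; rewrite wE; ring.
(* Euler's identity bounds the radial part by [m M] and Bernstein's inequality the tangential part
   by [m M], whence the factor 2. *)
rewrite (euler_homog _ hp) (le_trans (ler_normD _ _))// mulr2n lerD//.
  rewrite !normrM (ger0_norm (ler0n _ _)) -[leRHS]mul1r ler_pM ?mulr_ge0//.
    exact: unit_sphere_coord.
  by rewrite ler_wpM2l// pM.
have [w0|w0] := eqVneq (\sum_j w 0 j ^+ 2) 0.
  rewrite big1 ?normr0// => j _.
  move/eqP: w0; rewrite psumr_eq0 => [|k _]; last exact: sqr_ge0.
  by move/allP => /(_ j (mem_index_enum _)); rewrite sqrf_eq0 => /eqP ->; rewrite mul0r.
have ww0 : 0 < \sum_j w 0 j ^+ 2.
  by rewrite lt_def w0 sumr_ge0// => j _; exact: sqr_ge0.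
pose s := Num.sqrt (\sum_j w 0 j ^+ 2).
have s0 : 0 < s by rewrite sqrtr_gt0.
have s1 : s <= 1.
  by rewrite -[leRHS]sqrtr1 ler_wsqrtr// ww lerBlDr lerDl sqr_ge0.
have hv : unit_sphere (s^-1 *: w).
  apply/unit_sphereE; under eq_bigr do rewrite mxE exprMn.
  by rewrite -mulr_sumr exprVn sqr_sqrtr ?mulVf// ltW.
have xv : \sum_j x 0 j * (s^-1 *: w) 0 j = 0.
  by under eq_bigr do rewrite mxE mulrCA; rewrite -mulr_sumr xw mulr0.
have := meval_tangent_le (dhomog_mdeg_le (leqnn m) hp) pM hx hv xv.
under eq_bigr do rewrite mxE -mulrA.
rewrite -mulr_sumr normrM gtr0_norm ?invr_gt0// => h.
apply: le_trans h; by rewrite ler_peMl// invf_ge1.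
Qed.

(** * A net on the sphere *)

Lemma sin_le_id (R : realType) (t : R) : 0 <= t -> sin t <= t.
Proof.
rewrite le_eqVlt => /predU1P[<-|t0]; first by rewrite sin0.
have [c _] := MVT t0 (fun x _ => is_derive_sin x)
  (continuous_subspaceT (@continuous_sin R)).
by rewrite sin0 !subr0 => ->; rewrite ler_piMl// ?cos_le1// ltW.
Qed.

Lemma cos_ge_quadratic (R : realType) (t : R) : 0 <= t -> 1 - t ^+ 2 / 2 <= cos t.
Proof.
move=> t0; have -> : t = (t / 2) *+ 2 by field.
rewrite cos_mulr2n cos2sin2.
have -> : (1 - sin (t / 2) ^+ 2) *+ 2 - 1 = 1 - sin (t / 2) ^+ 2 *+ 2 by ring.
have [h|h] := leP (sin (t / 2)) 0.
  have s0 := sin_geN1 (t / 2); have : - (t / 2) <= sin (t / 2).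
    have [u|u] := leP t pi; last by have := pi_ge2 R; lra.
    have : 0 <= sin (t / 2) by apply: sin_ge0_pi; lra.
    by lra.
  by nra.
have := sin_le_id (divr_ge0 t0 (ler0n R 2)); nra.
Qed.

Lemma cos_le_quadratic (R : realType) (t : R) : 0 <= t <= 1 / 2 -> cos t <= 1 - t ^+ 2 / 4.
Proof.
move=> /andP[]; rewrite le_eqVlt => /predU1P[<- _|t0 t1].
  by rewrite cos0; lra.
have u0 : 0 < t / 2 by lra.
have [c] := MVT u0 (fun x _ => is_derive_sin x) (continuous_subspaceT (@continuous_sin R)).
rewrite in_itv /= sin0 !subr0 => /andP[c0 cu] hs.
have hc := cos_ge_quadratic (ltW c0).
(* Here [c < t / 2 <= 1 / 4], so [c^2 / 2 <= 1 / 32]; the constant [1 / 4] of the statement, instead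
   of the sharp [1 / 2], leaves room for this loss. *)
have hc2 : 31 / 32 <= cos c by nra.
have -> : cos t = 1 - sin (t / 2) ^+ 2 *+ 2.
  have -> : t = (t / 2) *+ 2 by field.
  rewrite cos_mulr2n cos2sin2; have -> : t / 2 *+ 2 / 2 = t / 2 by field.
  ring.
rewrite hs.
have : (31 / 32) * (t / 2) <= cos c * (t / 2) by rewrite ler_pM2r.
by move: (cos c * (t / 2)) => z; nra.
Qed.

Lemma acos_le (R : realType) (c t : R) : 0 <= t <= 1 / 2 ->
  1 - t ^+ 2 / 4 <= c <= 1 -> acos c <= t.
Proof.
move=> ht /andP[hc c1].
have cI : -1 <= c <= 1 by move/andP: ht => [? ?]; rewrite c1 andbT; nra.
rewrite leNgt; apply/negP => tc.
have := cos_le_quadratic ht; apply/negP; rewrite -ltNge; apply: le_lt_trans hc _.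
have aI : acos c \in `[0, pi] by rewrite in_itv /= acos_ge0// acos_lepi.
have tI : t \in `[0, pi].
  by rewrite in_itv /=; move: ht (pi_ge2 R) => /andP[-> ?] ?; lra.
by rewrite -(acosK (x := c)) ?in_itv//= ltr_cos.
Qed.

(** The points are joined by an arc of a great circle of length [acos (x . y)], along which [p] is
    Lipschitz with constant [N M] by Bernstein's inequality. *)
Lemma meval_arc_le (R : realType) (n N : nat) (p : mpoly n R) (x y : 'rV[R]_n) (M : R) :
  mdeg_le N p -> (forall z, unit_sphere z -> `|meval (z 0) p| <= M) ->
  unit_sphere x -> unit_sphere y -> 0 <= \sum_i x 0 i * y 0 i ->
  `|meval (y 0) p - meval (x 0) p| <= N%:R * M * acos (\sum_i x 0 i * y 0 i).
Proof.
move=> hN pM hx hy; set c := \sum_i _ => c0.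
have /unit_sphereE hx1 := hx; have /unit_sphereE hy1 := hy.
have d2 : \sum_i (x 0 i - y 0 i) ^+ 2 = 2 - c *+ 2.
  transitivity (\sum_i (x 0 i ^+ 2 + y 0 i ^+ 2 - (x 0 i * y 0 i) *+ 2)).
    by apply: eq_bigr => i _; ring.
  by rewrite sumrB big_split /= hx1 hy1 sumrMnl -/c; ring.
have d20 : 0 <= \sum_i (x 0 i - y 0 i) ^+ 2 by apply: sumr_ge0 => i _; exact: sqr_ge0.
have c1 : c <= 1 by move: d20; rewrite d2; lra.
move: c1; rewrite le_eqVlt => /predU1P[c1|c1].
  have /eqP : \sum_i (x 0 i - y 0 i) ^+ 2 = 0 by rewrite d2 c1; ring.
  rewrite psumr_eq0 => [/allP h|i _]; last exact: sqr_ge0.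
  have -> : y = x.
    apply/rowP => i; have := h i (mem_index_enum _).
    by rewrite sqrf_eq0 subr_eq0 => /eqP.
  by rewrite subrr normr0 c1 acos1 mulr0.
have cI : -1 <= c <= 1 by lra.
(* Gram-Schmidt: [s] is the sine of the angle between [x] and [y], nonzero as [c < 1], and [v] is
   the unit tangent at [x] towards [y]. *)
pose s := Num.sqrt (1 - c ^+ 2).
have s20 : 0 < 1 - c ^+ 2 by nra.
have s0 : 0 < s by rewrite sqrtr_gt0.
pose v := s^-1 *: (y - c *: x).
have vE i : v 0 i = s^-1 * (y 0 i - c * x 0 i) by rewrite !mxE.
have xv : \sum_i x 0 i * v 0 i = 0.
  transitivity (\sum_i s^-1 * (x 0 i * y 0 i - c * (x 0 i ^+ 2))).
    by apply: eq_bigr => i _; rewrite vE; ring.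
  by rewrite -mulr_sumr sumrB -/c -mulr_sumr hx1 mulr1 subrr mulr0.
have hv : unit_sphere v.
  apply/unit_sphereE; transitivity (\sum_i s^-1 ^+ 2 * (y 0 i ^+ 2 -
      (c *+ 2) * (x 0 i * y 0 i) + c ^+ 2 * (x 0 i ^+ 2))).
    by apply: eq_bigr => i _; rewrite vE; ring.
  rewrite -mulr_sumr big_split sumrB /= -!mulr_sumr hx1 hy1 -/c.
  have -> : 1 - c *+ 2 * c + c ^+ 2 * 1 = 1 - c ^+ 2 by ring.
  by rewrite exprVn sqr_sqrtr ?ltW// mulVf// lt0r_neq0.
have := trigpoly_lipschitz (trigpoly_meval (x 0) (v 0) hN)
  (fun t => meval_great_circle_le t pM hx hv xv) (acos_ge0 cI).
congr (`|_ - _| <= _); congr (meval _ _); apply/funext => i.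
  rewrite acosK ?in_itv// sin_acos// -/s vE mulrA divff ?mul1r; last exact: lt0r_neq0.
  by rewrite addrC subrK.
by rewrite cos0 sin0 mul1r mul0r addr0.
Qed.

(** A crude bound, used to know that the supremum on the sphere is finite and to bound the finitely
    many uncontrolled initial terms. *)
Lemma meval_coef_le (R : realType) (n : nat) (p : mpoly n R) (z : 'rV[R]_n) :
  unit_sphere z -> `|meval (z 0) p| <= \sum_(m <- msupp p) `|mcoeff m p|.
Proof.
move=> hz; rewrite mevalE (le_trans (ler_norm_sum _ _ _))//; apply: ler_sum => m _.
rewrite normrM ler_piMr// normr_prod.
apply: prodr_ile1 => i _; rewrite normr_ge0 normrX exprn_ile1//.
exact: unit_sphere_coord.
Qed.

(** The cell of [x] in a cubic grid of mesh [1 / K]. The shift by 1 makes the coordinates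
    nonnegative, so that on the sphere the truncations lie in [0, ..., 2K] and [inord] does not
    alter them. *)
Definition sphere_code (R : realType) (n K : nat) (x : 'rV[R]_n) :
    {ffun 'I_n -> 'I_K.*2.+1} :=
  [ffun i => inord (Num.truncn ((x 0 i + 1) * K%:R))].

(** One point of the sphere from each cell that meets it. A cell that misses the sphere gets a
    default point of the sphere, so that the net can be indexed by all codes. *)
Definition sphere_net (R : realType) (n K : nat) (c : {ffun 'I_n.+1 -> 'I_K.*2.+1}) :
    'rV[R]_n.+1 :=
  xget (delta_mx 0 ord0) [set x | unit_sphere x /\ sphere_code K x = c].

Lemma sphere_net_unit (R : realType) (n K : nat) (c : {ffun 'I_n.+1 -> 'I_K.*2.+1}) :
  unit_sphere (sphere_net R c).
Proof.
rewrite /sphere_net; case: xgetP => [_ -> [] //|_].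
apply/unit_sphereE; rewrite (bigD1 ord0)//= big1 => [|i i0].
  by rewrite mxE !eqxx expr1n addr0.
by rewrite mxE eqxx (negbTE i0) expr0n.
Qed.

Lemma sphere_code_net (R : realType) (n K : nat) (x : 'rV[R]_n.+1) :
  unit_sphere x -> sphere_code K (sphere_net R (sphere_code K x)) = sphere_code K x.
Proof.
by move=> hx; rewrite /sphere_net; case: xgetP => [_ -> [] //|/(_ x)[]].
Qed.

Lemma sphere_code_close (R : realType) (n K : nat) (x y : 'rV[R]_n) (i : 'I_n) :
  unit_sphere x -> unit_sphere y -> sphere_code K x = sphere_code K y ->
  `|x 0 i - y 0 i| * K%:R <= 1.
Proof.
move=> hx hy /ffunP /(_ i); rewrite !ffunE => /(congr1 (@nat_of_ord _)).
have tr (z : 'rV[R]_n) : unit_sphere z -> 0 <= (z 0 i + 1) * K%:R /\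
    (Num.truncn ((z 0%R i + 1)%R * K%:R)%R < K.*2.+1)%N.
  move=> /(unit_sphere_coord i); rewrite ler_norml => /andP[h1 h2].
  have h0 : 0 <= (z 0 i + 1) * K%:R by rewrite mulr_ge0//; lra.
  split=> //; rewrite truncn_lt_nat//.
  have K0 : 0 <= K%:R :> R by [].
  by rewrite -natr1 -mul2n natrM; nra.
have [x0 xK] := tr _ hx; have [y0 yK] := tr _ hy.
rewrite !inordK// => e.
have := truncn_itv x0; have := truncn_itv y0; rewrite e -natr1 => /andP[a1 a2] /andP[b1 b2].
rewrite -[K%:R]ger0_norm// -normrM ler_norml; apply/andP; split; lra.
Qed.

(* Every point of the sphere is within angle [1 / 2N] of the net, and over such an angle [p] varies by at
   most half its supremum. *)
Lemma sphere_net_le (R : realType) (n N K : nat) (p : mpoly n.+1 R) (A : R) :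
  (0 < N)%N -> K = (8 * n.+1 * N)%N -> mdeg_le N p ->
  (forall c : {ffun 'I_n.+1 -> 'I_K.*2.+1}, `|meval (sphere_net R c 0) p| <= A) ->
  forall x, unit_sphere x -> `|meval (x 0) p| <= A *+ 2.
Proof.
move=> N0 KE hN pA x hx.
pose S := [set `|meval (z 0) p| | z in @unit_sphere R n.+1].
have S0 : S !=set0 by exists `|meval (x 0) p|; exists x.
have Sub : has_ubound S.
  by exists (\sum_(m <- msupp p) `|mcoeff m p|) => _ [z hz <-]; exact: meval_coef_le.
have pM z : unit_sphere z -> `|meval (z 0) p| <= sup S.
  by move=> hz; apply: ub_le_sup => //; exists z.
(* The variation of [p] is measured by the supremum itself; being finite, it can be absorbed in the
   left side. *)
suff h : sup S <= A + sup S / 2 by have := pM x hx; lra.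
apply: ge_sup => // _ [z hz <-].
pose y := sphere_net R (sphere_code K z).
have hy : unit_sphere y := sphere_net_unit R _.
have cl i := sphere_code_close i hy hz (sphere_code_net K hz).
have Nr0 : 1 <= N%:R :> R by rewrite ler1n.
have K0 : 0 < K%:R :> R by rewrite ltr0n KE !muln_gt0.
have d2 : \sum_i (y 0 i - z 0 i) ^+ 2 <= n.+1%:R / K%:R ^+ 2.
  rewrite ler_pdivlMr ?exprn_gt0// mulr_suml.
  apply: (@le_trans _ _ (\sum_(i < n.+1) 1)); last by rewrite sumr_const card_ord.
  apply: ler_sum => i _; rewrite -exprMn -[leLHS]real_normK ?num_real// exprn_ile1//.
  by rewrite normrM (ger0_norm (ltW K0)).
have /unit_sphereE hy1 := hy; have /unit_sphereE hz1 := hz.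
set c := \sum_i y 0 i * z 0 i.
have d2E : \sum_i (y 0 i - z 0 i) ^+ 2 = 2 - c *+ 2.
  transitivity (\sum_i (y 0 i ^+ 2 + z 0 i ^+ 2 - (y 0 i * z 0 i) *+ 2)).
    by apply: eq_bigr => i _; ring.
  by rewrite sumrB big_split /= hy1 hz1 sumrMnl -/c; ring.
have d20 : 0 <= \sum_i (y 0 i - z 0 i) ^+ 2 by apply: sumr_ge0 => i _; exact: sqr_ge0.
(* The choice of [K] is spent here: with [t = 1 / 2N] it gives [|y - z|^2 <= t^2 / 2], that is
   [y . z >= 1 - t^2 / 4], the hypothesis of [acos_le]. *)
have d3 : n.+1%:R / K%:R ^+ 2 <= ((2 * N%:R)^-1) ^+ 2 / 2 :> R.
  rewrite exprVn -invfM ler_pdivrMr ?exprn_gt0// mulrC ler_pdivlMr; last first.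
    by rewrite mulr_gt0// exprn_gt0//; lra.
  rewrite KE !natrM.
  have : 1 <= n.+1%:R :> R by rewrite ler1n.
  move: (n.+1%:R) (N%:R) Nr0 => a b b1 a1.
  have : a <= a ^+ 2 by nra.
  have : 0 <= b ^+ 2 by nra.
  by nra.
set t := (2 * N%:R)^-1 in d3.
have t0 : 0 < t by rewrite invr_gt0; lra.
have t1 : t <= 1 / 2 by rewrite /t invfM -[leRHS]mulr1 mul1r ler_pM2l// invf_le1//; lra.
have c0 : 0 <= c by nra.
have hac : acos c <= t by apply: acos_le; nra.
have := meval_arc_le hN pM hy hz c0; rewrite -/c => h.
have S00 : 0 <= sup S := le_trans (normr_ge0 _) (pM x hx).
have h2 : N%:R * sup S * acos c <= sup S / 2.
  apply: (@le_trans _ _ (N%:R * sup S * t)).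
    by rewrite ler_wpM2l// mulr_ge0//; lra.
  by rewrite /t invfM (mulrC 2^-1) mulrACA divff ?mul1r// lt0r_neq0//; lra.
have : `|meval (z 0) p| <= `|meval (z 0) p - meval (y 0) p| + `|meval (y 0) p|.
  by rewrite -{1}(subrK (meval (y 0) p) (meval (z 0) p)) ler_normD.
by have := pA (sphere_code K z); rewrite -/y; lra.
Qed.

(** * Doubling weights and Abel summation *)

Lemma growth_gt0 (R : realType) (w : R -> R) (x : R) : weight w -> 1 <= x -> 0 < growth w x.
Proof.
move=> hw x1; rewrite invr_gt0; apply: weight_gt0 hw _ _.
have x0 : 0 < x by lra.
by rewrite subr_ge0 invf_le1// x1 ltrBlDr ltrDl invr_gt0.
Qed.

Lemma growth_le (R : realType) (w : R -> R) (x y : R) : weight w -> 1 <= x -> x <= y ->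
  growth w x <= growth w y.
Proof.
move=> hw x1 xy; have x0 : 0 < x by lra.
have y0 : 0 < y by lra.
have := growth_gt0 hw x1; have := growth_gt0 hw (le_trans x1 xy).
rewrite /growth !invr_gt0 => wy wx; rewrite lef_pV2//.
apply: (weight_decr hw); first by rewrite subr_ge0 invf_le1.
  by rewrite lerB// lef_pV2.
by rewrite ltrBlDr ltrDl invr_gt0.
Qed.

(** The doubling condition at [t = 1 / x]. Its constant [1 / B] is rounded up to a power of two, so
    that iteration yields a power of the ratio of the arguments. *)
Lemma growth_double (R : realType) (w : R -> R) : weight w ->
  exists k : nat, forall x : R, 1 <= x -> growth w (2 * x) <= 2 ^+ k * growth w x.
Proof.
move=> hw; have [B B0 hB] := weight_doubling hw.
exists (Num.truncn B^-1).+1 => x x1.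
have x0 : 0 < x by lra.
have := growth_gt0 hw x1.
have := @growth_gt0 _ _ (2 * x) hw; rewrite /growth !invr_gt0 => /(_ ltac:(lra)) w2 w1.
have := hB x^-1; rewrite invr_gt0 x0 invf_le1// x1 => /(_ isT).
have -> : x^-1 / 2 = (2 * x)^-1 by rewrite invfM mulrC.
move=> h; have h2 : (w (1 - (2 * x)^-1))^-1 <= B^-1 / w (1 - x^-1).
  by rewrite -invfM lef_pV2 ?posrE ?mulr_gt0.
apply: le_trans h2 _; rewrite ler_wpM2r ?invr_ge0 ?(ltW w1)//.
apply: (@le_trans _ _ ((Num.truncn B^-1).+1%:R)); last first.
  by rewrite -natrX ler_nat ltnW// ltn_expl.
have /truncn_itv /andP[_ /ltW//] : 0 <= B^-1 by rewrite invr_ge0 ltW.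
Qed.

(** Each doubling of [x] multiplies both [growth w x] and the [k]-th power of the argument by at
    most, respectively exactly, [2^k]. The extra factor 2 in the base pays for the last, incomplete
    doubling. *)
Lemma growth_poly (R : realType) (w : R -> R) : weight w ->
  exists k : nat, forall x y : R, 1 <= x -> x <= y ->
    growth w y <= (2 * (y / x)) ^+ k * growth w x.
Proof.
move=> hw; have [k hk] := growth_double hw; exists k => x y x1 xy.
have [j hj] : exists j : nat, y <= 2 ^+ j * x.
  exists (Num.truncn y).+1; have y0 : 0 <= y by lra.
  have /andP[_ /ltW h] := truncn_itv y0; apply: le_trans h _.
  rewrite -[leLHS]mulr1 ler_pM// -natrX ler_nat ltnW// ltn_expl//.
elim: j x x1 xy hj => [|j IH] x x1 xy hj.
  have -> : y = x by apply/eqP; rewrite eq_le xy andbT -[leRHS]mul1r -(expr0 2).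
  rewrite divff ?mulr1; last by rewrite lt0r_neq0//; lra.
  by rewrite ler_peMl ?(ltW (growth_gt0 hw x1))// exprn_ege1//; lra.
have x0 : 0 < x by lra.
have yx1 : 1 <= y / x by rewrite ler_pdivlMr// mul1r.
have g0 : 0 <= growth w x by rewrite ltW// growth_gt0.
have [y2|y2] := leP y (2 * x).
  apply: le_trans (growth_le hw _ y2) _; first lra.
  apply: le_trans (hk x x1) _; rewrite ler_wpM2r// lerXn2r ?nnegrE//; lra.
have := IH (2 * x) ltac:(lra) (ltW y2) ltac:(by rewrite mulrA -exprSr).
move=> h; apply: le_trans h _.
have -> : 2 * (y / (2 * x)) = y / x by field; rewrite lt0r_neq0.
rewrite [X in _ <= X * _]exprMn [X in _ <= X * _]mulrC -mulrA ler_wpM2l ?hk//.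
by rewrite exprn_ge0//; lra.
Qed.

(** A partial sum of the binomial series of [(1 - r)^(-(k+1))]. *)
Definition binom_sum (R : realType) (k M : nat) (r : R) : R :=
  \sum_(N < M) 'C(N + k, k)%:R * r ^+ N.

(** Multiplication by [1 - r] lowers the order by one, up to a boundary term. Both summands on the
    left are nonnegative for [0 <= r < 1]: keeping the first bounds the sums, keeping the second
    bounds single terms. *)
Lemma binom_sumS (R : realType) (k M : nat) (r : R) :
  (1 - r) * binom_sum k.+1 M r + r ^+ M * 'C(M + k, k.+1)%:R = binom_sum k M r.
Proof.
rewrite /binom_sum; elim: M => [|M IH].
  by rewrite !big_ord0 mulr0 add0r add0n bin_small// mulr0.
rewrite !big_ord_recr /= -IH addSn addnS (binS (M + k) k) natrD exprS; ring.
Qed.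

Lemma binom_sum_ge0 (R : realType) (k M : nat) (r : R) : 0 <= r -> 0 <= binom_sum k M r.
Proof. by move=> r0; apply: sumr_ge0 => i _; rewrite mulr_ge0// exprn_ge0. Qed.

Lemma binom_sum_le (R : realType) (k M : nat) (r : R) : 0 <= r < 1 ->
  binom_sum k M r <= (1 - r)^-1 ^+ k.+1.
Proof.
move=> /andP[r0 r1]; have r10 : 0 < 1 - r by lra.
elim: k => [|k IH].
  rewrite expr1 -[leRHS]mul1r ler_pdivlMr//.
  have -> : binom_sum 0 M r = \sum_(i < M) r ^+ i.
    by apply: eq_bigr => i _; rewrite bin0 mul1r.
  have := subrX1 r M; have := exprn_ge0 M r0.
  by move: (\sum_(i < M) _) (r ^+ M) => S q q0 h; nra.
rewrite exprS mulrC ler_pdivlMr// mulrC; apply: le_trans IH.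
by rewrite -(binom_sumS k M) lerDl mulr_ge0// exprn_ge0.
Qed.

Lemma binom_term_le (R : realType) (k M : nat) (r : R) : 0 <= r < 1 ->
  r ^+ M * 'C(M + k, k)%:R <= (1 - r)^-1 ^+ k.
Proof.
move=> hr; have /andP[r0 r1] := hr.
case: k => [|k]; first by rewrite addn0 bin0 mulr1 exprn_ile1// ltW.
apply: le_trans (binom_sum_le k M.+1 hr).
rewrite addnS binS natrD mulrDr addrC /binom_sum big_ord_recr /= [leRHS]addrC mulrC lerD//.
by rewrite -/(binom_sum k M r) -(binom_sumS k M) lerDr mulr_ge0 ?binom_sum_ge0//; lra.
Qed.

(** The right side is the product [(N + 1) ... (N + k)]; powers are thus traded for coefficients of
    the binomial series. *)
Lemma expn_le_binom (k N : nat) : (N.+1 ^ k <= k`! * 'C(N + k, k))%N.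
Proof.
rewrite mulnC bin_ffact; elim: k => [|k IH]; first by rewrite expn0 ffactn0.
by rewrite addnS ffactSS expnS leq_mul// ltnS leq_addr.
Qed.

Lemma pow_geom_sum_le (R : realType) (k M : nat) (r : R) : 0 <= r < 1 ->
  \sum_(N < M) N.+1%:R ^+ k * r ^+ N <= k`!%:R * (1 - r)^-1 ^+ k.+1.
Proof.
move=> hr; have /andP[r0 r1] := hr.
apply: (@le_trans _ _ (k`!%:R * binom_sum k M r)); last by rewrite ler_wpM2l ?binom_sum_le.
rewrite mulr_sumr; apply: ler_sum => N _; rewrite mulrA ler_wpM2r ?exprn_ge0//.
by rewrite -natrX -natrM ler_nat expn_le_binom.
Qed.

Lemma pow_geom_le (R : realType) (k M : nat) (r : R) : 0 <= r < 1 ->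
  M.+1%:R ^+ k * r ^+ M <= k`!%:R * (1 - r)^-1 ^+ k.
Proof.
move=> hr; have /andP[r0 r1] := hr.
apply: (@le_trans _ _ (k`!%:R * (r ^+ M * 'C(M + k, k)%:R))); last first.
  by rewrite ler_wpM2l ?binom_term_le.
rewrite mulrCA mulrC ler_wpM2l ?exprn_ge0//.
by rewrite -natrX -natrM ler_nat expn_le_binom.
Qed.

Lemma is_cvg_pow_geom (R : realType) (k : nat) (C r : R) : 0 <= C -> 0 <= r < 1 ->
  cvgn (series (fun m => C * (m.+1%:R ^+ k * r ^+ m))).
Proof.
move=> C0 hr; have /andP[r0 r1] := hr.
apply: nondecreasing_is_cvgn.
  by apply: nondecreasing_series => m _ _; rewrite !mulr_ge0// exprn_ge0.
exists (C * (k`!%:R * (1 - r)^-1 ^+ k.+1)) => _ [M _ <-].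
by rewrite /series /= -mulr_sumr big_mkord ler_wpM2l// pow_geom_sum_le.
Qed.

Lemma abel_sum (R : realType) (e : nat -> R) (r : R) (M : nat) :
  \sum_(m < M) e m * r ^+ m =
  (1 - r) * \sum_(N < M) (\sum_(m < N.+1) e m) * r ^+ N + r ^+ M * \sum_(m < M) e m.
Proof.
elim: M => [|M IH]; first by rewrite !big_ord0 !mulr0 addr0.
rewrite !big_ord_recr /= IH exprS.
move: (\sum_(_ < M) _ * _) => X; move: (\sum_(_ < M) _) => Y; ring.
Qed.

(** With [x = 1 / (1 - r)], the weights [(1 - r) r^N] of Abel's formula have mass at most 1 and live
    on [N] of order [x]. Beyond [x] the growth function exceeds its value at [x] by at most a
    multiple of [(N / x)^k], and the [k]-th moment of the weights is [O(x^k)]. *)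
Lemma abel_growth_le (R : realType) (w : R -> R) : weight w ->
  exists2 K : R, 0 <= K & forall (e : nat -> R) (C r : R) (M : nat), 0 <= C -> 0 <= r < 1 ->
    (forall N, `|\sum_(m < N) e m| <= C * growth w N.+1%:R) ->
    `|\sum_(m < M) e m * r ^+ m| <= K * C * growth w (1 - r)^-1.
Proof.
move=> hw; have [k hk] := growth_poly hw.
(* The [1] accounts for indices up to [x], the rest for those beyond. [D] bounds the main sum and
   the boundary term of Abel's formula separately, whence [D + D]. *)
pose D : R := 1 + 2 ^+ k * (2 ^+ k * k`!%:R).
have D0 : 0 <= D by rewrite addr_ge0// !mulr_ge0// exprn_ge0.
exists (D + D); first by rewrite addr_ge0.
move=> e C r M C0 hr he; have /andP[r0 r1] := hr; have r10 : 0 < 1 - r by lra.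
set x := (1 - r)^-1; have x1 : 1 <= x by rewrite invf_ge1//; lra.
have x0 : 0 < x by lra.
have gx0 := growth_gt0 hw x1.
have rx : 1 - r = x^-1 by rewrite /x invrK.
(* The index is [N.+2] because Abel's formula uses sums of [N.+1] terms; one factor [2 ^+ k] comes
   from [growth_poly], the other from [N + 2 <= 2 (N + 1)]. *)
have hg N : growth w N.+2%:R <= (1 + 2 ^+ k * (2 ^+ k * (N.+1%:R ^+ k * (1 - r) ^+ k))) * growth w x.
  have p0 : 0 <= 2 ^+ k * (2 ^+ k * (N.+1%:R ^+ k * (1 - r) ^+ k)).
    by rewrite !mulr_ge0// exprn_ge0// ltW.
  have [Nx|Nx] := leP N.+2%:R x.
    apply: le_trans (growth_le hw _ Nx) _; first by rewrite ler1n.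
    by rewrite ler_peMl ?(ltW gx0)// lerDl.
  apply: le_trans (hk x _ x1 (ltW Nx)) _; rewrite ler_wpM2r ?(ltW gx0)//.
  apply: (@le_trans _ _ (2 ^+ k * (2 ^+ k * (N.+1%:R ^+ k * (1 - r) ^+ k)))); last by rewrite lerDr.
  rewrite -!exprMn lerXn2r ?nnegrE ?mulr_ge0 ?invr_ge0// ?(ltW r10)// ?(ltW x0)//.
  rewrite ler_wpM2l// -rx mulrA ler_wpM2r ?(ltW r10)//.
  by rewrite -natrM ler_nat; lia.
have hg1 N : growth w N.+1%:R <= growth w N.+2%:R.
  by apply: growth_le => //; rewrite ?ler1n// ler_nat.
have sum1 : (1 - r) * \sum_(N < M) r ^+ N <= 1.
  have := @pow_geom_sum_le _ 0 M r hr; rewrite fact0 mul1r expr1.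
  under eq_bigr do rewrite expr0 mul1r.
  by rewrite mulrC -ler_pdivlMr// mul1r.
have xk : x ^+ k * (1 - r) ^+ k = 1 by rewrite -exprMn rx divff ?expr1n// lt0r_neq0.
rewrite abel_sum (le_trans (ler_normD _ _))//.
rewrite -[leRHS]mulrA [leRHS]mulrDl; apply: lerD.
  rewrite normrM (gtr0_norm r10).
  apply: (@le_trans _ _ ((1 - r) * \sum_(N < M)
      C * ((1 + 2 ^+ k * (2 ^+ k * (N.+1%:R ^+ k * (1 - r) ^+ k))) * growth w x) * r ^+ N)).
    rewrite ler_wpM2l ?(ltW r10)// (le_trans (ler_norm_sum _ _ _))//; apply: ler_sum => N _.
    rewrite normrM [in X in _ * X]ger0_norm ?exprn_ge0// ler_wpM2r ?exprn_ge0//.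
    by apply: le_trans (he _) _; rewrite ler_wpM2l.
  have -> : (1 - r) * \sum_(N < M)
      C * ((1 + 2 ^+ k * (2 ^+ k * (N.+1%:R ^+ k * (1 - r) ^+ k))) * growth w x) * r ^+ N =
     (C * growth w x) * ((1 - r) * \sum_(N < M) r ^+ N +
       2 ^+ k * (2 ^+ k * ((1 - r) ^+ k.+1 * \sum_(N < M) N.+1%:R ^+ k * r ^+ N))).
    rewrite !mulr_sumr -big_split /= mulr_sumr; apply: eq_bigr => N _.
    rewrite [(1 - r) ^+ k.+1]exprS; ring.
  rewrite [leRHS]mulrC ler_wpM2l ?mulr_ge0 ?(ltW gx0)// lerD// !ler_wpM2l ?exprn_ge0//.
  rewrite -[leRHS]mulr1 mulrC.
  have := @pow_geom_sum_le _ k M r hr; rewrite -/x => h.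
  apply: le_trans (ler_wpM2r _ h) _; first by rewrite exprn_ge0// ltW.
  by rewrite -mulrA ler_wpM2l// !exprS mulrACA xk mulr1 rx divff// lt0r_neq0.
rewrite normrM (ger0_norm (exprn_ge0 _ r0)).
apply: (@le_trans _ _ (r ^+ M *
    (C * ((1 + 2 ^+ k * (2 ^+ k * (M.+1%:R ^+ k * (1 - r) ^+ k))) * growth w x)))).
  rewrite ler_wpM2l ?exprn_ge0//; apply: le_trans (he _) _; rewrite ler_wpM2l//.
  exact: le_trans (hg1 _) (hg _).
have -> : r ^+ M * (C * ((1 + 2 ^+ k * (2 ^+ k * (M.+1%:R ^+ k * (1 - r) ^+ k))) * growth w x)) =
  (C * growth w x) * (r ^+ M + 2 ^+ k * (2 ^+ k * (M.+1%:R ^+ k * r ^+ M * (1 - r) ^+ k))) by ring.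
rewrite [leRHS]mulrC ler_wpM2l ?mulr_ge0 ?(ltW gx0)//.
rewrite /D lerD//.
  by rewrite exprn_ile1// ltW.
rewrite !ler_wpM2l ?exprn_ge0//.
apply: le_trans (ler_wpM2r _ (pow_geom_le k M hr)) _; first by rewrite exprn_ge0// ltW.
by rewrite -/x -mulrA xk mulr1.
Qed.

(** * Termwise limits and derivatives *)

Lemma cvg_series_dominated (R : realType) (f M : R^nat) :
  (forall m, `|f m| <= M m) -> cvgn (series M) -> cvgn (series f).
Proof.
move=> fM cM; apply: normed_cvg; apply: (series_le_cvg _ _ fM cM) => m; first exact: normr_ge0.
exact: le_trans (normr_ge0 _) (fM m).
Qed.

Lemma series_tail_le (R : realType) (f M : R^nat) (N : nat) :
  (forall m, `|f m| <= M m) -> cvgn (series M) ->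
  `|limn (series f) - series f N| <= limn (series M) - series M N.
Proof.
move=> fM cM; have cf := cvg_series_dominated fM cM.
have c1 : `|series f n - series f N| @[n --> \oo] --> `|limn (series f) - series f N|.
  by apply: cvg_norm; apply: cvgB => //; exact: cvg_cst.
have c2 : series M n - series M N @[n --> \oo] --> limn (series M) - series M N.
  by apply: cvgB => //; exact: cvg_cst.
apply: (ler_cvg_to c1 c2); near=> n; have Nn : (N <= n)%N by near: n; exact: nbhs_infty_ge.
by rewrite !sub_series_geq// (le_trans (ler_norm_sum _ _ _))// ler_sum.
Unshelve. all: by end_near. Qed.

(** Dominated convergence for series. A general filter covers both continuity at a point and
    difference quotients, which live on a punctured neighbourhood. *)
Lemma tannery (R : realType) (T : Type) (F : set_system T) (f : nat -> T -> R) (l M : nat -> R) :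
  ProperFilter F -> (forall m, f m x @[x --> F] --> l m) ->
  (\forall x \near F, forall m, `|f m x| <= M m) -> cvgn (series M) ->
  limn (series (f ^~ x)) @[x --> F] --> limn (series l).
Proof.
move=> FF fl fM cM.
have lM m : `|l m| <= M m.
  apply: (cvgr_to_le (cvg_norm (fl m))).
  by near=> x; move: m; near: x.
apply/cvgrPdist_lt => e e0.
have e3 : 0 < e / 3 by lra.
have /cvgrPdist_lt /(_ _ e3) [N _ hN] := cM.
have {}hN := hN N (leqnn N); rewrite /= in hN.
have cN : series (f ^~ x) N @[x --> F] --> series l N.
  by rewrite /series; apply: cvg_big => // *; exact: add_continuous.
have /cvgrPdist_lt /(_ _ e3) hc := cN.
near=> x.
have fMx m : `|f m x| <= M m by move: m; near: x.
have h1 := series_tail_le N fMx cM; have h2 := series_tail_le N lM cM.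
have h3 : `|series l N - series (f ^~ x) N| < e / 3 by near: x.
have h4 := le_lt_trans (ler_norm _) hN.
have -> : limn (series l) - limn (series (f^~ x)) = (limn (series l) - series l N) +
   (series l N - series (f ^~ x) N) - (limn (series (f^~ x)) - series (f ^~ x) N) by ring.
have := ler_normB ((limn (series l) - series l N) +
   (series l N - series (f ^~ x) N)) (limn (series (f^~ x)) - series (f ^~ x) N).
have := ler_normD (limn (series l) - series l N) (series l N - series (f ^~ x) N).
lra.
Unshelve. all: by end_near. Qed.

Lemma is_derive_line (R : realType) (V : normedModType R) (f : V -> R) (x v : V) (t d : R) :
  is_derive (t *: v + x) v f d -> is_derive t (1 : R) (fun s : R => f (s *: v + x)) d.
Proof.
move=> [h1 h2].
have e : (fun h : R => h^-1 *: (((fun s : R => f (s *: v + x)) \o shift t) (h *: (1 : R)) - f (t *: v + x))) =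
   (fun h : R => h^-1 *: ((f \o shift (t *: v + x)) (h *: v) - f (t *: v + x))).
  apply/funext => h /=; congr (_ *: (f _ - _)).
  by rewrite [h *: 1]mulr1 scalerDl addrA.
by split; [rewrite /derivable e|rewrite /derive e].
Qed.

Lemma line_lipschitz (R : realType) (V : normedModType R) (f : V -> R) (df : V -> R) (x v : V) (M r h : R) :
  (forall y, is_derive y v f (df y)) -> (forall t, `|t| < r -> `|df (t *: v + x)| <= M) ->
  `|h| < r -> `|f (h *: v + x) - f x| <= M * `|h|.
Proof.
move=> hf hM hr.
pose g (s : R) := f (s *: v + x).
have hg (t : R) : is_derive t (1 : R) g (df (t *: v + x)) by exact: is_derive_line.
have cg (a b : R) : {within `[a, b], continuous g}.
  by apply: derivable_within_continuous => t _; case: (hg t).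
have key (a b : R) : a < b -> `|a| < r -> `|b| < r -> `|g b - g a| <= M * (b - a).
  move=> ab ar br.
  have [c] := MVT ab (fun t _ => hg t) (cg a b).
  rewrite in_itv /= => /andP[ac cb] ->.
  rewrite normrM (gtr0_norm (x := b - a)) ?subr_gt0// ler_wpM2r ?subr_ge0 ?(ltW ab)//.
  apply: hM; move: ar br; rewrite !ltr_norml => /andP[? ?] /andP[? ?].
  by apply/andP; split; lra.
have r0 : 0 < r := le_lt_trans (normr_ge0 _) hr.
have g0 : g 0 = f x by rewrite /g scale0r add0r.
rewrite -g0 -/(g h); have [h0|h0|->] := ltgtP h 0.
- have := key h 0 h0 hr; rewrite normr0 => /(_ r0).
  by rewrite distrC sub0r (ltr0_norm h0).
- have := key 0 h h0; rewrite normr0 => /(_ r0 hr).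
  by rewrite subr0 (gtr0_norm h0).
- by rewrite subrr normr0 mulr0.
Qed.

(** The mean value theorem on the line through [x] dominates the difference quotients by the bounds
    on the derivatives, so that [tannery] applies to them. *)
Lemma is_derive_series (R : realType) (V : normedModType R) (f df : nat -> V -> R)
    (x v : V) (M : nat -> R) :
  (forall m y, is_derive y v (f m) (df m y)) ->
  (\forall y \near x, (forall m, `|df m y| <= M m) /\ cvgn (series (f ^~ y))) ->
  cvgn (series M) ->
  is_derive x v (fun y => limn (series (f ^~ y))) (limn (series (df ^~ x))).
Proof.
move=> hf hx cM.
have /nbhs_normP [e /= e0 he] := hx.
(* [|t| < r] keeps [t *: v + x] within [e] of [x]; the [1 +] avoids a division by zero. *)
pose r := e / (1 + `|v|).
have v1 : 0 < 1 + `|v| by rewrite ltr_pwDl.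
have r0 : 0 < r by rewrite divr_gt0.
have hr (t : R) : `|t| < r -> (forall m, `|df m (t *: v + x)| <= M m) /\
    cvgn (series (f ^~ (t *: v + x))).
  move=> tr; apply: he; rewrite /ball_ /= opprD addrCA subrr addr0 normrN normrZ.
  apply: (@le_lt_trans _ _ (`|t| * (1 + `|v|))); first by rewrite ler_wpM2l// lerDr.
  by rewrite -ltr_pdivlMr.
pose q m (h : R) := h^-1 * (f m (h *: v + x) - f m x).
have hq : limn (series (q ^~ h)) @[h --> 0^'] --> limn (series (df ^~ x)).
  apply: (@tannery _ _ _ q (df ^~ x) M) => //.
    move=> m; have [d <-] := hf m x; exact: d.
  near=> h => m; have h0 : h != 0 by near: h; exact: nbhs_dnbhs_neq.
  have hh : `|h| < r by near: h; exact: dnbhs0_lt.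
  have := line_lipschitz (hf m) (fun t tr => (hr t tr).1 m) hh.
  by move=> hl; rewrite /q normrM normfV mulrC ler_pdivrMr ?normr_gt0.
have cx : cvgn (series (f ^~ x)).
  by have [|_] := hr 0; rewrite ?normr0// scale0r add0r.
have hlim : (fun h : R => h^-1 *: (((fun y => limn (series (f ^~ y))) \o shift x) (h *: v) -
     limn (series (f ^~ x)))) @ 0^' --> limn (series (df ^~ x)).
  apply: cvg_trans hq; apply: near_eq_cvg; near=> h.
  have h0 : h != 0 by near: h; exact: nbhs_dnbhs_neq.
  have hh : `|h| < r by near: h; exact: dnbhs0_lt.
  have [_ ch] := hr h hh.
  apply: cvg_lim => //=.
  have -> : series (q ^~ h) = (fun n => h^-1 * (series (f ^~ (h *: v + x)) n - series (f ^~ x) n)).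
    by apply/funext => n; rewrite /series /= -sumrB mulr_sumr.
  by apply: cvgMl_tmp; apply: cvgB.
split; first by apply/cvg_ex; eexists; exact: hlim.
exact: cvg_lim hlim.
Unshelve. all: by end_near. Qed.

Lemma continuous_series (R : realType) (V : normedModType R) (f : nat -> V -> R)
    (x : V) (M : nat -> R) :
  (forall m, {for x, continuous (f m)}) ->
  (\forall y \near x, forall m, `|f m y| <= M m) -> cvgn (series M) ->
  {for x, continuous (fun y => limn (series (f ^~ y)))}.
Proof.
by move=> hf hM cM; apply: (tannery _ hf hM cM).
Qed.

(** * Series of homogeneous harmonic polynomials *)

Lemma enorm_ge0 (R : realType) (n : nat) (x : 'rV[R]_n) : 0 <= enorm x.
Proof. exact: sqrtr_ge0. Qed.

Lemma enorm_eq0 (R : realType) (n : nat) (x : 'rV[R]_n) : (enorm x == 0) = (x == 0).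
Proof.
apply/idP/eqP => [|->]; last first.
  by rewrite /enorm big1 ?sqrtr0// => i _; rewrite mxE expr0n.
rewrite /enorm sqrtr_eq0 => h.
have {}h : \sum_i x 0 i ^+ 2 = 0.
  by apply/le_anti; rewrite h sumr_ge0// => i _; exact: sqr_ge0.
apply/rowP => i; rewrite mxE; move/eqP: h; rewrite psumr_eq0 => [|j _]; last exact: sqr_ge0.
by move=> /allP /(_ i (mem_index_enum _)); rewrite sqrf_eq0 => /eqP.
Qed.

Lemma enormZ (R : realType) (n : nat) (c : R) (x : 'rV[R]_n) : enorm (c *: x) = `|c| * enorm x.
Proof.
rewrite /enorm; under eq_bigr do rewrite mxE exprMn.
by rewrite -mulr_sumr sqrtrM ?sqr_ge0// sqrtr_sqr.
Qed.

Lemma enorm_le (R : realType) (n : nat) (x : 'rV[R]_n) (A : R) : 0 <= A ->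
  (forall i, `|x 0 i| <= A) -> enorm x <= n%:R * A.
Proof.
case: n x => [x _ _|n x A0 hA].
  by rewrite /enorm big_ord0 sqrtr0 mul0r.
have nA0 : 0 <= n.+1%:R * A by rewrite mulr_ge0.
rewrite -(ger0_norm nA0) -sqrtr_sqr ler_wsqrtr//.
apply: (@le_trans _ _ (\sum_(i < n.+1) A ^+ 2)).
  by apply: ler_sum => i _; rewrite -real_normK ?num_real// lerXn2r ?nnegrE.
rewrite sumr_const card_ord exprMn -[leLHS]mulr_natl ler_wpM2r ?exprn_ge0//.
by rewrite -natrX ler_nat leq_pmulr.
Qed.

Lemma continuous_enorm (R : realType) (n : nat) : continuous (@enorm R n).
Proof.
move=> x; rewrite /enorm; apply: (@continuous_comp _ _ _ (fun y : 'rV[R]_n => \sum_i y 0 i ^+ 2) Num.sqrt).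
  apply: (cvg_big (@add_continuous _) (nbhs_filter x)) => i _.
  by apply: (@cvgM _ _ _ _ (fun y : 'rV[R]_n => y 0 i) (fun y : 'rV[R]_n => y 0 i)); exact: coord_continuous.
exact: sqrt_continuous.
Qed.

Lemma direction_unit (R : realType) (n : nat) (x : 'rV[R]_n.+1) : unit_sphere (direction x).
Proof.
rewrite /direction; have [x0|x0] := eqVneq x 0.
  apply/unit_sphereE; rewrite (bigD1 ord0)//= big1 => [|i i0].
    by rewrite mxE !eqxx expr1n addr0.
  by rewrite mxE eqxx (negbTE i0) expr0n.
rewrite /unit_sphere /= enormZ ger0_norm ?invr_ge0 ?enorm_ge0//.
by rewrite mulVf// enorm_eq0.
Qed.

Lemma direction_scale (R : realType) (n : nat) (x : 'rV[R]_n.+1) :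
  x = enorm x *: direction x.
Proof.
rewrite /direction; have [->|x0] := eqVneq x 0.
  by have /eqP -> : enorm (0 : 'rV[R]_n.+1) == 0; rewrite ?scale0r// enorm_eq0.
by rewrite scalerA divff ?scale1r// enorm_eq0.
Qed.

Lemma meval_polar (R : realType) (n m : nat) (p : mpoly n.+1 R) (x : 'rV[R]_n.+1) :
  p \is ishomog1 m mdeg ->
  meval (x 0) p = enorm x ^+ m * meval (direction x 0) p.
Proof.
move=> hp; rewrite {1}(direction_scale x) -(meval_scale _ _ hp).
by congr (meval _ _); apply/funext => i; rewrite mxE.
Qed.

Lemma homog_ball_le (R : realType) (n m : nat) (p : mpoly n.+1 R) (x : 'rV[R]_n.+1) (A r : R) :
  p \is ishomog1 m mdeg -> (forall z, unit_sphere z -> `|meval (z 0) p| <= A) ->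
  enorm x <= r -> `|meval (x 0) p| <= A * r ^+ m.
Proof.
move=> hp hA xr; rewrite (meval_polar _ hp) normrM mulrC.
apply: ler_pM => //; first by apply: hA; exact: direction_unit.
by rewrite ger0_norm ?exprn_ge0 ?enorm_ge0// lerXn2r ?nnegrE ?enorm_ge0// (le_trans (enorm_ge0 _) xr).
Qed.

Lemma near_unit_ball (R : realType) (n : nat) (x : 'rV[R]_n) : unit_ball x ->
  \forall y \near x, enorm y <= (1 + enorm x) / 2.
Proof.
rewrite /unit_ball /= => x1.
have : \forall y \near x, enorm y < (1 + enorm x) / 2.
  by apply: (cvgr_lt _ (@continuous_enorm R n x)); lra.
by apply: filterS => y /ltW.
Qed.

(* Sequences of homogeneous polynomials of degrees [m - s] that grow at most polynomially in [m] on the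
   sphere; [s] counts the derivatives taken. *)
Definition tame (R : realType) (n s : nat) (h : nat -> mpoly n R) : Prop :=
  (forall m, h m \is ishomog1 (m - s)%N mdeg) /\
  exists C k, 0 <= C /\ forall m z, unit_sphere z -> `|meval (z 0) (h m)| <= C * m.+1%:R ^+ k.

Definition sumseries (R : realType) (n : nat) (h : nat -> mpoly n R) (x : 'rV[R]_n) : R :=
  limn (series (fun m => meval (x 0) (h m))).

(** The gradient bound on the sphere costs a factor [2 m]: the exponent [k] grows by one and [C]
    doubles. *)
Lemma tame_mderiv (R : realType) (n s : nat) (h : nat -> mpoly n R) (i : 'I_n) :
  tame s h -> tame s.+1 (fun m => mderiv i (h m)).
Proof.
move=> [hh [C [k [C0 hC]]]]; split.
  by move=> m; rewrite subnS; exact: dhomog_mderiv.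
exists (C *+ 2), k.+1; split; first by rewrite mulrn_wge0.
move=> m z hz; apply: le_trans (homog_partial_le i (hh m) (hC m) hz) _.
rewrite [leRHS]mulrnAl ler_wMn2r// mulrCA ler_wpM2l// exprS ler_wpM2r ?exprn_ge0// ler_nat.
by rewrite (leq_trans (leq_subr _ _)).
Qed.

Lemma tame_ball (R : realType) (n s : nat) (h : nat -> mpoly n.+1 R) (r : R) :
  tame s h -> 0 < r < 1 ->
  exists2 M : nat -> R, cvgn (series M) &
    forall m x, enorm x <= r -> `|meval (x 0) (h m)| <= M m.
Proof.
move=> [hh [C [k [C0 hC]]]] /andP[r0 r1].
(* The factor [r^(-s)] pays for the [s] lost degrees; for [m < s], where [m - s] is [0], the bound
   holds because [r < 1]. *)
exists (fun m => (C * r^-1 ^+ s) * (m.+1%:R ^+ k * r ^+ m)).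
  apply: is_cvg_pow_geom; first by rewrite mulr_ge0// exprn_ge0// invr_ge0 ltW.
  by rewrite (ltW r0).
move=> m x xr; apply: le_trans (homog_ball_le (hh m) (hC m) xr) _.
rewrite [leRHS]mulrACA ler_wpM2l ?mulr_ge0 ?exprn_ge0//.
rewrite exprVn mulrC ler_pdivlMr ?exprn_gt0// -exprD.
by apply: ler_wiXn2l; [rewrite ltW|rewrite ltW|lia].
Qed.

Lemma tame_cvg (R : realType) (n s : nat) (h : nat -> mpoly n.+1 R) (x : 'rV[R]_n.+1) :
  tame s h -> unit_ball x -> cvgn (series (fun m => meval (x 0) (h m))).
Proof.
move=> th hx; rewrite /unit_ball /= in hx.
have [|M cM hM] := @tame_ball _ _ _ _ ((1 + enorm x) / 2) th.
  by have := enorm_ge0 x; lra.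
by apply: (cvg_series_dominated _ cM) => m; apply: hM; lra.
Qed.

Lemma tame_near (R : realType) (n s : nat) (h : nat -> mpoly n.+1 R) (x : 'rV[R]_n.+1) :
  tame s h -> unit_ball x -> exists2 M : nat -> R, cvgn (series M) &
  \forall y \near x, forall m, `|meval ((y : 'rV[R]_n.+1) 0) (h m)| <= M m.
Proof.
move=> th hx; have := near_unit_ball hx; rewrite /unit_ball /= in hx => nx.
have [|M cM hM] := @tame_ball _ _ _ _ ((1 + enorm x) / 2) th.
  by have := enorm_ge0 x; lra.
by exists M => //; apply: filterS nx => y hy m; exact: hM.
Qed.

Lemma near_unit_ballT (R : realType) (n : nat) (x : 'rV[R]_n) : unit_ball x ->
  \forall y \near x, unit_ball y.
Proof.
move=> hx; have := near_unit_ball hx; rewrite /unit_ball /= in hx *.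
by apply: filterS => y /= h; rewrite /unit_ball /=; lra.
Qed.

Lemma tame_continuous (R : realType) (n s : nat) (h : nat -> mpoly n.+1 R) (x : 'rV[R]_n.+1) :
  tame s h -> unit_ball x -> {for x, continuous (sumseries h)}.
Proof.
move=> th hx; have [M cM hM] := tame_near th hx.
apply: (@continuous_series _ _ (fun m (y : 'rV[R]_n.+1) => meval (y 0) (h m)) _ M) => //.
by move=> m; exact: continuous_meval.
Qed.

Lemma tame_derive (R : realType) (n s : nat) (h : nat -> mpoly n.+1 R) (i : 'I_n.+1) (x : 'rV[R]_n.+1) :
  tame s h -> unit_ball x ->
  is_derive x (delta_mx 0 i) (sumseries h) (sumseries (fun m => mderiv i (h m)) x).
Proof.
move=> th hx; have [M cM hM] := tame_near (tame_mderiv i th) hx.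
apply: (@is_derive_series _ _ (fun m (y : 'rV[R]_n.+1) => meval (y 0) (h m))
  (fun m (y : 'rV[R]_n.+1) => meval (y 0) (mderiv i (h m))) _ _ M) => //.
  by move=> m y; exact: is_derive_meval_partial.
have nx := near_unit_ballT hx.
by near=> y; split; [near: y|apply: (tame_cvg th); near: y].
Unshelve. all: by end_near. Qed.

Lemma tame_partial (R : realType) (n s : nat) (h : nat -> mpoly n.+1 R) (i : 'I_n.+1) (x : 'rV[R]_n.+1) :
  tame s h -> unit_ball x ->
  partial i (sumseries h) x = sumseries (fun m => mderiv i (h m)) x.
Proof. by move=> th hx; have [_] := tame_derive i th hx. Qed.

Lemma tame_partial_near (R : realType) (n s : nat) (h : nat -> mpoly n.+1 R) (i : 'I_n.+1) (x : 'rV[R]_n.+1) :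
  tame s h -> unit_ball x ->
  \forall y \near x, sumseries (fun m => mderiv i (h m)) y = partial i (sumseries h) y.
Proof.
move=> th hx; apply: filterS (near_unit_ballT hx) => y hy.
by rewrite (tame_partial i th hy).
Qed.

Lemma near_eq_continuous_at (R : realType) (V : normedModType R) (f g : V -> R) (x : V) :
  (\forall y \near x, f y = g y) -> {for x, continuous f} -> {for x, continuous g}.
Proof.
move=> fg cf; have e : f x = g x by exact: (nbhs_singleton fg).
rewrite /prop_for /continuous_at -e.
by apply: cvg_trans cf; apply: near_eq_cvg.
Qed.

(** Partial derivatives are identified with termwise ones only inside the ball, so each derivability
    and continuity statement is transferred through an equality near [x]. *)
Lemma tame_C2 (R : realType) (n s : nat) (h : nat -> mpoly n.+1 R) :
  tame s h -> C2_on (@unit_ball R n.+1) (sumseries h).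
Proof.
move=> th x hx; split.
- exact: tame_continuous th hx.
- move=> i; split; first by have [] := tame_derive i th hx.
  apply: near_eq_continuous_at (tame_partial_near i th hx) _.
  exact: tame_continuous (tame_mderiv i th) hx.
- move=> i j; have nx := tame_partial_near i th hx; have thi := tame_mderiv i th; split.
    apply: near_eq_derivable nx _.
    by have [] := tame_derive j thi hx.
  apply: near_eq_continuous_at (tame_continuous (tame_mderiv j thi) hx).
  apply: filterS (near_unit_ballT hx) => y hy.
  rewrite -(tame_partial j thi hy); apply: near_eq_derive.
  exact: (tame_partial_near i th hy).
Qed.

Lemma tame_harmonic (R : realType) (n s : nat) (h : nat -> mpoly n.+1 R) :
  tame s h -> (forall m (x : 'rV[R]_n.+1), \sum_i meval (x 0) (mderiv i (mderiv i (h m))) = 0) ->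
  harmonic_on (@unit_ball R n.+1) (sumseries h).
Proof.
move=> th hl; split; first exact: tame_C2 th.
move=> x hx; rewrite /laplacian.
pose q i m := meval (x 0) (mderiv i (mderiv i (h m))).
have cq i : series (q i) @ \oo --> partial i (partial i (sumseries h)) x.
  have thi := tame_mderiv i th.
  have -> : partial i (partial i (sumseries h)) x = sumseries (fun m => mderiv i (mderiv i (h m))) x.
    rewrite -(tame_partial i thi hx); apply: near_eq_derive.
    by apply: filterS (tame_partial_near i th hx) => y /esym.
  exact: (tame_cvg (tame_mderiv i thi) hx).
have cs : \sum_i series (q i) N @[N --> \oo] --> \sum_i partial i (partial i (sumseries h)) x.
  by apply: cvg_big => // ; exact: add_continuous.
have c0 : \sum_i series (q i) N @[N --> \oo] --> (0 : R).
  have -> : (fun N => \sum_i series (q i) N) = cst 0.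
    apply/funext => N; rewrite /series /= exchange_big big1// => m _; exact: hl.
  exact: cvg_cst.
exact: (cvg_unique _ cs c0).
Qed.

Lemma mderiv_dhomog0 (R : realType) (n : nat) (p : mpoly n R) (i : 'I_n) :
  p \is ishomog1 0 mdeg -> mderiv i p = 0.
Proof.
move=> hp; apply/mpolyP => m.
by rewrite mcoeff_mderiv mcoeff0 (dhomog_nemf_coeff hp) ?mul0rn//= mdegD mdeg1 addn1.
Qed.

(** The deterministic half of the argument. The bound on partial sums is used twice: crudely, to
    make [h] tame, and precisely, through Abel summation along each radius. *)
Theorem sumseries_bloch (R : realType) (n : nat) (w : R -> R) (h : nat -> mpoly n.+1 R) (C : R) :
  weight w -> 0 <= C -> (forall m, h m \is ishomog1 m mdeg) ->
  (forall m (x : 'rV[R]_n.+1), \sum_i meval (x 0) (mderiv i (mderiv i (h m))) = 0) ->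
  (forall N i (z : 'rV[R]_n.+1), unit_sphere z ->
     `|\sum_(m < N.+1) meval (z 0) (mderiv i (h m))| <= C * growth w N.+1%:R) ->
  (forall x : 'rV[R]_n.+1, unit_ball x -> cvgn (series (fun m => meval (x 0) (h m)))) /\
  bloch w (sumseries h).
Proof.
move=> hw C0 hh hl hC.
have [k hk] := growth_poly hw.
have g1 : 0 < growth w 1 := growth_gt0 hw (lexx _).
have sC N i (z : 'rV[R]_n.+1) : unit_sphere z ->
    `|\sum_(m < N) meval (z 0) (mderiv i (h m))| <= C * growth w N.+1%:R.
  case: N => [_|N hz].
    by rewrite big_ord0 normr0 mulr_ge0// ltW// growth_gt0.
  apply: le_trans (hC N i z hz) _; rewrite ler_wpM2l// growth_le ?ler1n// ler_nat//.
(* A single term is the difference of two consecutive partial sums. *)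
have dC m i (z : 'rV[R]_n.+1) : unit_sphere z -> `|meval (z 0) (mderiv i (h m))| <= C *+ 2 * growth w m.+1%:R.
  move=> hz; have := sC m i z hz; have := hC m i z hz; rewrite big_ord_recr /=.
  move: (\sum_(_ < m) _) (meval _ _) (growth _ _) => x y g h1 h2.
  have := ler_normB (x + y) x; rewrite [x + y]addrC addrK => h3.
  by rewrite addrC in h1; lra.
have gk m : growth w m.+1%:R <= 2 ^+ k * growth w 1 * m.+1%:R ^+ k.
  have := hk 1 m.+1%:R (lexx _); rewrite ler1n divr1 exprMn => /(_ isT).
  by rewrite mulrAC.
have th : tame 0 h.
  split; first by move=> m; rewrite subn0.
  (* [c0] takes care of degree 0, about which derivatives say nothing; in positive degree Euler's
     identity recovers the values from the first derivatives. *)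
  pose c0 := `|meval (fun _ => 0) (h 0%N)|.
  pose D := n.+1%:R * (C *+ 2) * (2 ^+ k * growth w 1).
  have D0 : 0 <= D by rewrite !mulr_ge0 ?exprn_ge0 ?mulrn_wge0 ?(ltW g1).
  exists (c0 + D), k; split; first exact: addr_ge0 (normr_ge0 _) D0.
  case=> [|m] z hz.
    rewrite expr1n mulr1; have := meval_scale 0 (z 0) (hh 0%N).
    rewrite expr0 mul1r => <-; under [X in meval X]eq_fun do rewrite mul0r.
    by rewrite lerDl.
  apply: (@le_trans _ _ (D * m.+2%:R ^+ k)); last by rewrite ler_wpM2r ?exprn_ge0// lerDr normr_ge0.
  apply: (@le_trans _ _ (m.+1%:R * `|meval (z 0) (h m.+1)|)).
    by rewrite ler_peMl// ler1n.
  rewrite -[m.+1%:R]ger0_norm// -normrM -(euler_homog _ (hh m.+1)).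
  apply: le_trans (ler_norm_sum _ _ _) _.
  apply: (@le_trans _ _ (\sum_(i < n.+1) (C *+ 2 * (2 ^+ k * growth w 1 * m.+2%:R ^+ k)))).
    apply: ler_sum => i _; rewrite normrM -[leRHS]mul1r ler_pM//.
      exact: unit_sphere_coord.
    by apply: le_trans (dC _ _ _ hz) _; rewrite ler_wpM2l ?mulrn_wge0.
  by rewrite sumr_const card_ord -[leLHS]mulr_natl /D !mulrA.
split; first by move=> x hx; exact: (tame_cvg th hx).
split; first exact: tame_harmonic th hl.
have [K K0 hK] := abel_growth_le hw.
have pb i (z : 'rV[R]_n.+1) : unit_ball z ->
    `|partial i (sumseries h) z| <= K * C * growth w (1 - enorm z)^-1.
  move=> hz; rewrite (tame_partial i th hz).
  have cz := tame_cvg (tame_mderiv i th) hz.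
  apply: (cvgr_to_le (cvg_norm cz)).
  near=> N; have N0 : (0 < N)%N by near: N; exact: nbhs_infty_gt.
  (* The constant term drops out. After the shift the derivative of [h m.+1] is homogeneous of
     degree [m], which matches the power of the radius in the Abel sum. *)
  rewrite /series /= big_mkord -(prednK N0) big_ord_recl mderiv_dhomog0// meval0 add0r.
  have -> : \sum_(m < N.-1) meval (z 0) (mderiv i (h (bump 0 m))) =
     \sum_(m < N.-1) meval (direction z 0) (mderiv i (h m.+1)) * enorm z ^+ m.
    apply: eq_bigr => m _.
    by rewrite (meval_polar _ (dhomog_mderiv i (hh _))) /= mulrC.
  apply: (hK (fun m => meval (direction z 0) (mderiv i (h m.+1)))) => //.
    by rewrite enorm_ge0.
  move=> M; have := hC M i _ (direction_unit z).
  by rewrite big_ord_recl mderiv_dhomog0// meval0 add0r.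
rewrite /bloch_norm.
apply: (@le_lt_trans _ _ (`|sumseries h 0|%:E + (n.+1%:R * (K * C))%:E)%E); last exact: ltry.
apply: leeD => //; apply: ge_ereal_sup => _ [z hz <-]; rewrite lee_fin.
have hz1 : enorm z < 1 by [].
have r10 : 0 < 1 - enorm z by lra.
have wz : 0 < w (enorm z) by apply: (weight_gt0 hw); rewrite enorm_ge0.
have gz : growth w (1 - enorm z)^-1 = (w (enorm z))^-1.
  by rewrite /growth invrK opprB addrC subrK.
have gn : grad_norm (sumseries h) z <= n.+1%:R * (K * C * (w (enorm z))^-1).
  apply: enorm_le; first by rewrite !mulr_ge0// invr_ge0 ltW.
  by move=> i; rewrite mxE -gz; exact: pb.
apply: le_trans (ler_wpM2l (ltW wz) gn) _.
set W := w _ in wz *.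
have -> : W * (n.+1%:R * (K * C / W)) = n.+1%:R * (K * C) by field; rewrite lt0r_neq0.
exact: lexx.
Unshelve. all: by end_near. Qed.

(** * Independence and subnormal sums *)

Import HBNNSimple.

(** [c] stands for the expectation of [G]. Independence of [X] and [G] enters through indicators of
    [X] alone, and linearity extends it to simple functions. *)
Lemma integral_nnsfun_mul (R : realType) (d : measure_display) (T : measurableType d)
    (P : probability T R) (X : {RV P >-> R}) (G : T -> R) (c : R) (g : {nnsfun R >-> R}) :
  measurable_fun setT G -> (forall t, 0 <= G t) -> 0 <= c ->
  (forall A : set R, measurable A ->
     (\int[P]_t (\1_A (X t) * G t)%R%:E = c%:E * P (X @^-1` A))%E) ->
  (\int[P]_t (g (X t) * G t)%R%:E =
    c%:E * \sum_(y \in range g) (y%:E * P (X @^-1` (g @^-1` [set y]))))%E.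
Proof.
move=> mG G0 c0 hA.
have mgy (y : R) : measurable (g @^-1` [set y]) by exact: measurable_sfunP.
have mX := @measurable_funPT _ _ _ _ X.
have mind (y : R) : measurable_fun setT (fun t => \1_(g @^-1` [set y]) (X t) * G t).
  by apply: measurable_funM => //; exact: (measurableT_comp (@measurable_indic _ _ R setT _ (mgy y)) mX).
pose F (y : R) (t : T) : \bar R := (y%:E * (\1_(g @^-1` [set y]) (X t) * G t)%R%:E)%E.
have F0 y t : (0 <= F y t)%E.
  rewrite /F EFinM muleA; apply: mule_ge0; last by rewrite lee_fin.
  exact: nnfun_muleindic_ge0.
transitivity (\int[P]_t (\sum_(y \in range g) F y t))%E.
  apply: eq_integral => t _; rewrite fimfunE EFinM -fsumEFin//.
  rewrite ge0_mule_fsuml => [|y]; last exact: nnfun_muleindic_ge0.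
  by apply: eq_fsbigr => y _; rewrite /F -!EFinM mulrA.
rewrite ge0_integral_fsum//; last first.
  by move=> y; apply: measurable_funeM; exact/measurable_EFinP.
rewrite ge0_mule_fsumr; last first.
  move=> y; have [y0|y0] := leP 0 y; first by rewrite mule_ge0.
  suff -> : g @^-1` [set y] = set0 by rewrite preimage_set0 measure0 mule0.
  by apply/seteqP; split => // z /= gz; move: y0; rewrite -gz ltNge fun_ge0.
apply: eq_fsbigr => y; rewrite inE => -[z _ <-].
rewrite /F ge0_integralZl_EFin//.
- by rewrite hA// muleCA.
- by move=> t _; rewrite lee_fin mulr_ge0.
- exact/measurable_EFinP.
Qed.

(** Monotone convergence along simple approximations of [f], applied once with [G] and once with the
    constant 1 in its place. *)
Lemma integral_mul_indep (R : realType) (d : measure_display) (T : measurableType d)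
    (P : probability T R) (X : {RV P >-> R}) (G : T -> R) (c : R) (f : R -> R) :
  measurable_fun setT G -> (forall t, 0 <= G t) -> 0 <= c ->
  (forall A : set R, measurable A ->
     (\int[P]_t (\1_A (X t) * G t)%R%:E = c%:E * P (X @^-1` A))%E) ->
  measurable_fun setT f -> (forall x, 0 <= f x) ->
  (\int[P]_t (f (X t) * G t)%R%:E = c%:E * \int[P]_t (f (X t))%:E)%E.
Proof.
move=> mG G0 c0 hA mf f0.
have mX := @measurable_funPT _ _ _ _ X.
have mf' : measurable_fun setT (EFin \o f) by exact/measurable_EFinP.
pose g := nnsfun_approx measurableT mf'.
have cg x : EFin \o g^~ x @ \oo --> (f x)%:E.
  by apply: cvg_nnsfun_approx => // y _; rewrite lee_fin.
have ndg (x : R) : {homo (fun n => g n x) : m n / (m <= n)%N >-> m <= n}.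
  by move=> m n mn; exact/lefP/nd_nnsfun_approx.
have key (H : T -> R) : measurable_fun setT H -> (forall t, 0 <= H t) ->
    (\int[P]_t (g n (X t) * H t)%R%:E @[n --> \oo] --> \int[P]_t (f (X t) * H t)%R%:E)%E.
  move=> mH H0.
  have -> : (\int[P]_t (f (X t) * H t)%R%:E = \int[P]_t limn (fun n => (g n (X t) * H t)%R%:E))%E.
    apply: eq_integral => t _; apply/esym/cvg_lim => //.
    under eq_fun do rewrite EFinM; rewrite EFinM.
    by apply: cvgeZr => //; exact: cg.
  apply: cvg_monotone_convergence => //.
  - move=> n; apply/measurable_EFinP; apply: measurable_funM => //.
    exact: (measurableT_comp (@measurable_funPT _ _ _ _ (g n)) mX).
  - by move=> n t _; rewrite lee_fin mulr_ge0.
  - by move=> t _ m n mn; rewrite lee_fin ler_wpM2r// ndg.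
have h1 := key _ mG G0.
have h2 := key (cst 1) (measurable_cst _) (fun _ => ler01).
have e n : (\int[P]_t (g n (X t) * G t)%R%:E = c%:E * \int[P]_t (g n (X t) * cst 1 t)%R%:E)%E.
  rewrite (integral_nnsfun_mul _ mG G0 c0 hA).
  rewrite (@integral_nnsfun_mul _ _ _ P X (cst 1) 1 (g n)) ?mul1e// => A mA.
  under eq_integral do rewrite mulr1.
  rewrite mul1e (_ : (fun t => _) = fun t => (\1_(X @^-1` A) t)%:E); last first.
    by apply/funext => t; rewrite !indicE /=.
  rewrite integral_indic ?setIT//; rewrite -[_ @^-1` _]setTI; exact: mX.
have h3 : (\int[P]_t (g n (X t) * G t)%R%:E @[n --> \oo] --> c%:E * \int[P]_t (f (X t) * cst 1 t)%R%:E)%E.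
  under eq_fun do rewrite e.
  by apply: cvgeZl.
rewrite (cvg_unique _ h1 h3)//; congr (_ * _)%E; apply: eq_integral => t _.
by rewrite mulr1.
Qed.

(* The indicators are replaced by the functions [f i] one index at a time. *)
Lemma independent_prod (R : realType) (d : measure_display) (T : measurableType d)
    (P : probability T R) (I : eqType) (X : I -> {RV P >-> R}) (f : I -> R -> R)
    (M : I -> R) (s r : seq I) (E : I -> set R) :
  independent_family X ->
  (forall i, measurable_fun setT (f i)) -> (forall i x, 0 <= f i x) ->
  (forall i, (\int[P]_t (f i (X i t))%:E = (M i)%:E)%E) ->
  uniq (s ++ r) -> (forall i, measurable (E i)) ->
  (\int[P]_t ((\prod_(i <- s) f i (X i t)) * \prod_(i <- r) \1_(E i) (X i t))%R%:E =
   (\prod_(i <- s) M i)%:E * \prod_(i <- r) P (X i @^-1` E i))%E.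
Proof.
move=> indX mf f0 hM.
have mX i := @measurable_funPT _ _ _ _ (X i).
have M0 i : 0 <= M i.
  by rewrite -lee_fin -hM; apply: integral_ge0 => t _; rewrite lee_fin.
elim: s r E => [|i s IH] r E.
  move=> /= ur mE; rewrite big_nil mul1e -indX//.
  have mcap : measurable (\bigcap_(i in [set` r]) (X i @^-1` E i)).
    apply: fin_bigcap_measurable => // i _; rewrite -[_ @^-1` _]setTI; exact: mX.
  rewrite -[X in P X]setIT -(integral_indic _ measurableT mcap).
  apply: eq_integral => t _; rewrite big_nil mul1r; congr (_%:E).
  rewrite [RHS]indicE; case: (boolP (t \in _)) => [|/negP].
    rewrite inE => ht; rewrite big_seq big1// => i ir.
    by rewrite indicE mem_set//; exact: ht.
  rewrite inE => ht.
  have [i ir hi] : exists2 i, i \in r & ~ E i (X i t).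
    apply: contrapT => hn; apply: ht => i /= ir; apply: contrapT => hi.
    by apply: hn; exists i.
  by rewrite (big_rem i ir)/= indicE memNset// mul0r.
rewrite /= mem_cat negb_or -andbA => /and3P[is_ ir usr] mE.
pose p j := fine (P (X j @^-1` E j)).
have pE j : (p j)%:E = P (X j @^-1` E j).
  rewrite fineK// fin_num_measure// -[_ @^-1` _]setTI; exact: mX.
have pPE : (\prod_(j <- r) P (X j @^-1` E j) = (\prod_(j <- r) p j)%R%:E)%E.
  by rewrite -prodEFin; apply: eq_bigr => j _; rewrite pE.
pose G t := (\prod_(j <- s) f j (X j t)) * \prod_(j <- r) \1_(E j) (X j t).
have mG : measurable_fun setT G.
  apply: measurable_funM; apply: measurable_prod => j _.
    exact: (measurableT_comp (mf j) (mX j)).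
  exact: (measurableT_comp (@measurable_indic _ _ R setT _ (mE j)) (mX j)).
have G0 t : 0 <= G t by rewrite mulr_ge0// prodr_ge0.
have c0 : 0 <= \prod_(j <- s) M j * \prod_(j <- r) p j.
  by rewrite mulr_ge0// prodr_ge0// => j _; rewrite -lee_fin pE.
have key A : measurable A -> (\int[P]_t (\1_A (X i t) * G t)%R%:E =
    (\prod_(j <- s) M j * \prod_(j <- r) p j)%R%:E * P (X i @^-1` A))%E.
  (* Moving [i] into the list of indicators, with the set [A], lets the induction hypothesis supply
     what [integral_mul_indep] asks for. *)
  move=> mA; pose E' j := if j == i then A else E j.
  have mE' j : measurable (E' j) by rewrite /E'; case: ifP.
  have E'E j : j \in r -> E' j = E j.
    by move=> jr; rewrite /E'; case: eqP => // ji; move: ir; rewrite -ji jr.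
  have us : uniq (s ++ i :: r).
    by rewrite (perm_uniq (permEl (perm_catCA s [:: i] r))) /= mem_cat negb_or is_ ir.
  transitivity (\int[P]_t (\prod_(j <- s) f j (X j t) * \prod_(j <- i :: r) \1_(E' j) (X j t))%R%:E)%E.
    apply: eq_integral => t _; rewrite big_cons {1}/E' eqxx /G mulrCA; congr (_ * (_ * _))%:E.
    by apply: eq_big_seq => j jr; rewrite E'E.
  rewrite IH// big_cons {1}/E' eqxx.
  have -> : (\prod_(j <- r) P (X j @^-1` E' j) = (\prod_(j <- r) p j)%R%:E)%E.
    by rewrite -pPE; apply: eq_big_seq => j jr; rewrite E'E.
  by rewrite [X in (_ * X)%E]muleC muleA EFinM.
transitivity (\int[P]_t (f i (X i t) * G t)%R%:E)%E.
  by apply: eq_integral => t _; rewrite big_cons /G mulrA.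
rewrite (integral_mul_indep mG G0 c0 key (mf i) (f0 i)) hM pPE -!EFinM big_cons.
by congr (_%:E); rewrite mulrC mulrA.
Qed.

Lemma integral_prod_independent (R : realType) (d : measure_display) (T : measurableType d)
    (P : probability T R) (I : eqType) (X : I -> {RV P >-> R}) (f : I -> R -> R)
    (M : I -> R) (s : seq I) :
  independent_family X ->
  (forall i, measurable_fun setT (f i)) -> (forall i x, 0 <= f i x) ->
  (forall i, (\int[P]_t (f i (X i t))%:E = (M i)%:E)%E) -> uniq s ->
  (\int[P]_t (\prod_(i <- s) f i (X i t))%R%:E = (\prod_(i <- s) M i)%R%:E)%E.
Proof.
move=> indX mf f0 hM us.
have := @independent_prod _ _ _ P _ X f M s [::] (fun _ => setT) indX mf f0 hM.
rewrite cats0 big_nil mule1 => <- //.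
by apply: eq_integral => t _; rewrite big_nil mulr1.
Qed.

(** Independence factors the exponential moment, and subnormality at [l * c i] bounds each
    factor. *)
Lemma subnormal_sum_mgf (R : realType) (d : measure_display) (T : measurableType d)
    (P : probability T R) (I : eqType) (X : I -> {RV P >-> R}) (c : I -> R) (s : seq I) (l : R) :
  subnormal_sequence X -> uniq s ->
  ('M_P (fun t => (\sum_(i <- s) c i * X i t)%R) l <=
   (expR (l ^+ 2 * (\sum_(i <- s) c i ^+ 2) / 2))%:E)%E.
Proof.
move=> [indX subX] us.
pose f i (x : R) := expR (l * c i * x).
have mf i : measurable_fun setT (f i).
  by apply: continuous_measurable_fun => x; apply: continuous_comp;
    [exact: mulrl_continuous|exact: continuous_expR].
have fE i : (\int[P]_t (f i (X i t))%:E = 'M_P (X i) (l * c i))%E.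
  rewrite /mmt_gen_fun expectation.unlock; apply: eq_integral => t _ /=.
  by rewrite /f mulrC.
have fin i : (\int[P]_t (f i (X i t))%:E = (fine ('M_P (X i) (l * c i)))%:E)%E.
  rewrite fE fineK// -fE ge0_fin_numE; last first.
    by apply: integral_ge0 => t _; rewrite lee_fin expR_ge0.
  by rewrite fE; apply: le_lt_trans (subX i _) (ltry _).
have h := integral_prod_independent indX mf (fun i x => expR_ge0 _) fin us.
have e : (expR \o l \o* (fun t => \sum_(i <- s) c i * X i t)) =
    (fun t => \prod_(i <- s) f i (X i t)).
  apply/funext => t; rewrite /= mulrC mulr_sumr expR_sum.
  by apply: eq_bigr => i _; rewrite /f mulrA.
rewrite /mmt_gen_fun e expectation.unlock.
rewrite h lee_fin -mulrA mulr_suml mulr_sumr expR_sum.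
apply: ler_prod => i _; apply/andP; split; rewrite -lee_fin; rewrite -fin.
  by apply: integral_ge0 => t _; rewrite lee_fin expR_ge0.
by rewrite fE; apply: le_trans (subX i _) _; rewrite exprMn mulrA.
Qed.

Lemma measurable_gt (R : realType) (d : measure_display) (T : measurableType d)
    (f : T -> R) (a : R) :
  measurable_fun setT f -> measurable [set t | a < f t].
Proof.
move=> mf; have := mf measurableT `]a, +oo[%classic (measurable_itv _).
rewrite setTI; congr measurable; apply/seteqP.
by split => t /=; rewrite in_itv /= andbT.
Qed.

Lemma measurable_ge (R : realType) (d : measure_display) (T : measurableType d)
    (f : T -> R) (a : R) :
  measurable_fun setT f -> measurable [set t | a <= f t].
Proof.
move=> mf; have := mf measurableT `[a, +oo[%classic (measurable_itv _).
rewrite setTI; congr measurable; apply/seteqP.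
by split => t /=; rewrite in_itv /= andbT.
Qed.

(** Chernoff's bound for the coefficients [c] and [- c], whence the factor 2. *)
Lemma subnormal_sum_tail (R : realType) (d : measure_display) (T : measurableType d)
    (P : probability T R) (I : eqType) (X : I -> {RV P >-> R}) (c : I -> R) (s : seq I) (V tau : R) :
  subnormal_sequence X -> uniq s -> \sum_(i <- s) c i ^+ 2 <= V -> 0 < tau ->
  measurable [set t | tau * Num.sqrt V < `|\sum_(i <- s) c i * X i t|] /\
  (P [set t | tau * Num.sqrt V < `|\sum_(i <- s) c i * X i t|]%R
    <= (2 * expR (- (tau ^+ 2 / 2)))%R%:E)%E.
Proof.
move=> hX us cV tau0.
have mS (b : I -> R) : measurable_fun setT (fun t => \sum_(i <- s) b i * X i t).
  apply: measurable_sum => i; apply: measurable_funM => //; exact: measurable_funPT.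
have mA : measurable [set t | tau * Num.sqrt V < `|\sum_(i <- s) c i * X i t|].
  by apply: (@measurable_gt _ _ _ (fun t => `|\sum_(i <- s) c i * X i t|));
    apply: measurableT_comp => //; exact: mS.
split => //.
(* In the degenerate case all coefficients vanish, and the strict inequality makes the event
   empty. *)
have [V0|V0] := leP V 0.
  have cs0 : \sum_(i <- s) c i ^+ 2 = 0.
    apply/le_anti; rewrite (le_trans cV V0) sumr_ge0// => i _; exact: sqr_ge0.
  have ci i : i \in s -> c i = 0.
    move=> si; move/eqP: cs0; rewrite psumr_eq0 => [|j _]; last exact: sqr_ge0.
    by move=> /allP /(_ i si) /=; rewrite sqrf_eq0 => /eqP.
  rewrite (_ : [set t | _] = set0) ?measure0 ?lee_fin ?mulr_ge0 ?expR_ge0//.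
  apply/seteqP; split => // t /=; rewrite big_seq big1 ?normr0 => [|i si]; last by rewrite ci// mul0r.
  by rewrite ltNge mulr_ge0// ?sqrtr_ge0// ltW.
pose S (b : I -> R) : T -> R := fun t => \sum_(i <- s) b i * X i t.
pose mix b := isMeasurableFun.Build _ _ _ _ (S b) (mS b).
pose Y b : {RV P >-> R} := HB.pack (S b) (mix b).
set a := tau * Num.sqrt V.
have sV0 : 0 < Num.sqrt V by rewrite sqrtr_gt0.
have one (b : I -> R) : \sum_(i <- s) b i ^+ 2 <= V ->
    (P [set t | a <= S b t]%R <= (expR (- (tau ^+ 2 / 2)))%R%:E)%E.
  (* The optimal parameter: [r a = tau^2], while the exponential moment contributes [tau^2 / 2]. *)
  move=> bV; pose r := tau / Num.sqrt V.
  have r0 : 0 < r by rewrite divr_gt0.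
  apply: le_trans (@chernoff _ _ _ P (Y b) r a r0) _.
  apply: le_trans (lee_wpmul2r _ (subnormal_sum_mgf b r hX us)) _; first by rewrite lee_fin expR_ge0.
  rewrite -EFinM lee_fin -expRD ler_expR.
  have -> : r * a = tau ^+ 2 by rewrite /r /a; field; rewrite lt0r_neq0.
  have : r ^+ 2 * (\sum_(i <- s) b i ^+ 2) <= tau ^+ 2.
    apply: le_trans (ler_wpM2l (sqr_ge0 r) bV) _.
    by rewrite /r exprMn exprVn sqr_sqrtr ?(ltW V0)// -mulrA mulVf ?mulr1// lt0r_neq0.
  by lra.
have mone (b : I -> R) : measurable [set t | a <= S b t]%R.
  by apply: (@measurable_ge _ _ _ (S b)); exact: mS.
apply: (@le_trans _ _ (P ([set t | a <= S c t]%R `|` [set t | a <= S (fun i => - c i)%R t]%R))).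
  apply: le_measure; rewrite ?inE.
  - exact: mA.
  - exact: measurableU.
  - move=> t /=; rewrite /S; under [X in _ \/ _ <= X]eq_bigr do rewrite mulNr.
    rewrite sumrN; by case: (ger0P (\sum_(i <- s) c i * X i t)) => h /ltW h2; [left|right].
apply: le_trans (measureU2 P (mone _) (mone _)) _.
rewrite mulr_natl mulr2n EFinD; apply: leeD; first exact: one.
apply: one; rewrite (eq_bigr (fun i => c i ^+ 2))// => i _; exact: sqrrN.
Qed.

(** * Random blocks *)

Lemma measure_bigsetU_const_le (R : realType) (d : measure_display) (T : measurableType d)
    (P : probability T R) (I : Type) (s : seq I) (E : I -> set T) (b : R) :
  (forall i, measurable (E i)) -> (forall i, (P (E i) <= b%:E)%E) ->
  measurable (\big[setU/set0]_(i <- s) E i) /\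
  (P (\big[setU/set0]_(i <- s) E i) <= ((size s)%:R * b)%R%:E)%E.
Proof.
move=> mE hE; elim: s => [|i s [mU IH]].
  by rewrite big_nil measure0 mul0r.
rewrite big_cons; split; first exact: measurableU.
apply: le_trans (measureU2 P (mE i) mU) _.
rewrite /= -natr1 mulrDl mul1r addrC EFinD.
exact: leeD.
Qed.

(** For [n_k < N <= n_(k+1)] the whole of [t_(k+1)] is spent at once. This gives a multiple of
    [g(n_(k+1))], and the hypothesis on consecutive values of [g] brings it back to
    [g(n_k) <= g(N + 1)]. *)
Lemma block_growth_le (R : realType) (w : R -> R) (n : nat -> nat) (C1 C2 C3 A0 : R)
    (t e : nat -> R) (k0 : nat) :
  weight w -> (forall k, (0 < n k)%N) -> (forall k, (n k < n k.+1)%N) ->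
  0 <= C1 -> 0 <= C2 -> 0 <= C3 -> (forall k, 0 <= t k) ->
  (forall k, growth w (n k.+1)%:R <= C1 * growth w (n k)%:R) ->
  (forall k, \sum_(1 <= i < k.+1) t i <= C2 * growth w (n k)%:R) ->
  (forall N, (N <= n k0)%N -> `|\sum_(0 <= m < N.+1) e m| <= A0) ->
  (forall k N, (k0 <= k)%N -> (n k < N <= n k.+1)%N ->
    `|\sum_((n k).+1 <= m < N.+1) e m| <= C3 * t k.+1) ->
  forall N, `|\sum_(0 <= m < N.+1) e m| <= A0 + C1 * C2 * C3 * growth w N.+1%:R.
Proof.
move=> hw n0 nS c1 c2 c3 t0 hg hsum hA hB.
have gN N : 0 < growth w N.+1%:R by apply: growth_gt0; rewrite ?ler1n.
(* The second conjunct keeps the bound at block ends as a sum of the [t i]; unlike the bound by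
   [growth], it passes to the next block without loss. *)
have key k : (forall N, (N <= n (k + k0))%N ->
      `|\sum_(0 <= m < N.+1) e m| <= A0 + C1 * C2 * C3 * growth w N.+1%:R) /\
    `|\sum_(0 <= m < (n (k + k0)).+1) e m| <= A0 + C3 * \sum_(1 <= i < (k + k0).+1) t i.
  elim: k => [|k [IH1 IH2]].
    split=> [N Nn|]; apply: le_trans (hA _ _) _ => //; rewrite lerDl mulr_ge0 ?mulr_ge0//.
      by rewrite ltW.
    by apply: sumr_ge0 => i _; exact: t0.
  have step N : (n (k + k0) < N <= n (k + k0).+1)%N ->
      `|\sum_(0 <= m < N.+1) e m| <= A0 + C3 * \sum_(1 <= i < (k + k0).+2) t i.
    move=> hN; have /andP[nN _] := hN.
    rewrite (@big_cat_nat _ _ _ (n (k + k0)).+1)//=; last by rewrite ltnW.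
    apply: le_trans (ler_normD _ _) _.
    rewrite [in leRHS]big_nat_recr//= mulrDr addrA lerD//.
    by apply: hB => //; exact: leq_addl.
  split.
    move=> N Nn; have [Nk|Nk] := leqP N (n (k + k0)); first exact: IH1.
    have hN : (n (k + k0) < N <= n (k + k0).+1)%N by rewrite Nk.
    apply: le_trans (step N hN) _; rewrite lerD2l.
    rewrite [C1 * C2 * C3]mulrC -mulrA ler_wpM2l//.
    apply: le_trans (hsum _) _; rewrite [C1 * C2]mulrC -mulrA ler_wpM2l//.
    apply: le_trans (hg _) _; rewrite ler_wpM2l// growth_le ?ler1n//.
    by rewrite ler_nat ltnW// ltnS ltnW.
  by rewrite addSn; apply: step; rewrite leqnn nS.
move=> N; have [h _] := key N; apply: h.
have : (N + k0 < n (N + k0))%N.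
  by elim: (N + k0)%N => // j IH; exact: leq_ltn_trans IH (nS j).
by move/ltnW; apply: leq_trans; exact: leq_addr.
Qed.


Definition random_poly (dO : measure_display) (Omega : measurableType dO)
    (R : realType) (P : probability Omega R) (n : nat) (L : nat -> nat)
    (p : forall m, 'I_(L m).+1 -> mpoly n R) (a : forall m, 'I_(L m).+1 -> R)
    (xi : {m : nat & 'I_(L m).+1} -> {RV P >-> R}) (omega : Omega) (m : nat) : mpoly n R :=
  \sum_(l < (L m).+1) (a m l * xi (Tagged (fun m => 'I_(L m).+1) l) omega) *: p m l.

(** The coefficient of a variable is [a m l] times a derivative of absolute value at most [2 m]; the
    [4] in [4 * V] is the square of this 2. *)
Lemma random_poly_tail (dO : measure_display) (Omega : measurableType dO)
    (R : realType) (P : probability Omega R) (n : nat) (L : nat -> nat)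
    (p : forall m, 'I_(L m).+1 -> mpoly n R) (a : forall m, 'I_(L m).+1 -> R)
    (xi : {m : nat & 'I_(L m).+1} -> {RV P >-> R}) (i : 'I_n) (z : 'rV[R]_n)
    (lo N : nat) (V tau : R) :
  subnormal_sequence xi ->
  (forall m l, p m l \is ishomog1 m mdeg) ->
  (forall m l y, unit_sphere y -> `|meval (y 0) (p m l)| <= 1) ->
  unit_sphere z -> \sum_(lo <= m < N) m%:R ^+ 2 * sqnorm a m <= V -> 0 < tau ->
  let E := [set omega | tau * Num.sqrt (4 * V) <
     `|\sum_(lo <= m < N) meval (z 0) (mderiv i (random_poly p a xi omega m))|] in
  measurable E /\ (P E <= (2 * expR (- (tau ^+ 2 / 2)))%R%:E)%E.
Proof.
move=> hxi hp p1 hz hV tau0 /=.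
pose s := [seq Tagged (fun m => 'I_(L m).+1) l | m <- index_iota lo N, l <- enum 'I_(L m).+1].
pose c (j : {m : nat & 'I_(L m).+1}) : R :=
  a (tag j) (tagged j) * meval (z 0) (mderiv i (p (tag j) (tagged j))).
have us : uniq s.
  apply: allpairs_uniq_dep; first exact: iota_uniq.
    by move=> m _; exact: enum_uniq.
  by move=> [m l] [m' l'] _ _ /= h.
have sumE omega : \sum_(lo <= m < N) meval (z 0) (mderiv i (random_poly p a xi omega m)) =
    \sum_(j <- s) c j * xi j omega.
  rewrite /s big_allpairs_dep; apply: eq_bigr => m _.
  rewrite big_enum /= /random_poly (raddf_sum (mderiv i)) (raddf_sum (meval (z 0))).
  by apply: eq_bigr => l _; rewrite /= mderivZ mevalZ /c /=; ring.
have cV : \sum_(j <- s) c j ^+ 2 <= 4 * V.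
  apply: (@le_trans _ _ (4 * \sum_(lo <= m < N) m%:R ^+ 2 * sqnorm a m)); last by rewrite ler_wpM2l.
  rewrite /s big_allpairs_dep mulr_sumr; apply: ler_sum => m _.
  rewrite big_enum /= /sqnorm mulrA mulr_sumr; apply: ler_sum => l _.
  rewrite /c /= exprMn mulrC real_normK ?num_real// ler_wpM2r ?sqr_ge0//.
  have := homog_partial_le i (hp m l) (p1 m l) hz.
  rewrite mulr1 => h; rewrite -real_normK ?num_real//.
  have -> : 4 * m%:R ^+ 2 = (m%:R *+ 2) ^+ 2 :> R by ring.
  by rewrite lerXn2r ?nnegrE ?mulrn_wge0.
rewrite (_ : [set omega | _] =
  [set omega | tau * Num.sqrt (4 * V) < `|\sum_(j <- s) c j * xi j omega|]).
  exact: subnormal_sum_tail.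
by apply/seteqP; split=> omega /=; rewrite sumE.
Qed.

(* Union bound over the coordinates, the truncations and a net of polynomially many points. *)
Lemma random_block_event (dO : measure_display) (Omega : measurableType dO)
    (R : realType) (P : probability Omega R) (d : nat) (L : nat -> nat)
    (p : forall m, 'I_(L m).+1 -> mpoly d.+1 R) (a : forall m, 'I_(L m).+1 -> R)
    (xi : {m : nat & 'I_(L m).+1} -> {RV P >-> R}) (lo n : nat) :
  subnormal_sequence xi ->
  (forall m l, p m l \is ishomog1 m mdeg) ->
  (forall m l y, unit_sphere y -> `|meval (y 0) (p m l)| <= 1) ->
  (1 < n)%N ->
  exists B : set Omega, [/\ measurable B,
    (P B <= ((d.+1 * 2 * (24 * d.+1) ^ d.+1 * 2)%:R * n%:R ^- 2)%R%:E)%E &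
    forall omega, ~ B omega -> forall i N z, (N <= n)%N -> unit_sphere z ->
      `|\sum_(lo <= m < N.+1) meval (z 0) (mderiv i (random_poly p a xi omega m))| <=
      Num.sqrt (32 * (d + 4)%:R) *
        Num.sqrt ((\sum_(lo <= m < n.+1) m%:R ^+ 2 * sqnorm a m) * ln n%:R)].
Proof.
move=> hxi hp p1 n1.
set V := \sum_(lo <= m < n.+1) _.
have n0 : (0 < n)%N by exact: ltnW.
have n0r : 0 < n%:R :> R by rewrite ltr0n.
have ln0 : 0 < ln n%:R :> R by rewrite ln_gt0// ltr1n.
have sq0 m : 0 <= m%:R ^+ 2 * sqnorm a m.
  by rewrite mulr_ge0 ?sqr_ge0// sumr_ge0// => l _; rewrite sqr_ge0.
have V0 : 0 <= V by apply: sumr_ge0 => m _; exact: sq0.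
(* Each event has probability at most [2 n^(-(d+4))]: [d + 2] powers pay for the number of events,
   two remain for summability. *)
pose tau : R := Num.sqrt (2 * (d + 4)%:R * ln n%:R).
have d4 : 0 < (d + 4)%:R :> R by rewrite ltr0n addn4.
have tau0 : 0 < tau by rewrite sqrtr_gt0 !mulr_gt0.
have tau2 : tau ^+ 2 / 2 = (d + 4)%:R * ln n%:R.
  by rewrite sqr_sqrtr ?mulr_ge0 ?(ltW ln0)//; field.
pose K := (8 * d.+1 * n)%N.
pose I : finType := ('I_d.+1 * 'I_n.+1 * {ffun 'I_d.+1 -> 'I_K.*2.+1})%type.
pose E (x : I) : set Omega := [set omega | tau * Num.sqrt (4 * V) <
  `|\sum_(lo <= m < x.1.2.+1) meval (sphere_net R x.2 0)
      (mderiv x.1.1 (random_poly p a xi omega m))|].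
have hE x : measurable (E x) /\ (P (E x) <= (2 * expR (- (tau ^+ 2 / 2)))%R%:E)%E.
  apply: random_poly_tail => //; first exact: sphere_net_unit.
  rewrite /V; have [lN|Nl] := leqP lo x.1.2.+1.
    rewrite [leRHS](@big_cat_nat _ _ _ x.1.2.+1)//=.
    by rewrite lerDl; apply: sumr_ge0 => m _; exact: sq0.
  by rewrite big_geq ?(ltnW Nl).
have [mB hB] := measure_bigsetU_const_le (enum I) (fun x => (hE x).1) (fun x => (hE x).2).
exists (\big[setU/set0]_(x <- enum I) E x); split => //.
  apply: le_trans hB _; rewrite lee_fin tau2 -cardE.
  have -> : expR (- ((d + 4)%:R * ln n%:R)) = n%:R ^- (d + 4) :> R.
    by rewrite expRN mulrC expRM_natr lnK ?posrE.
  (* There are [n + 1 <= 2 n] truncations, and [2 K + 1 = 16 (d + 1) n + 1 <= 24 (d + 1) n] cells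
     per coordinate. *)
  have cI : (#|I| <= d.+1 * (2 * n) * (24 * d.+1 * n) ^ d.+1)%N.
    rewrite !card_prod card_ffun !card_ord; apply: leq_mul; first by rewrite leq_mul2l; lia.
    by rewrite leq_exp2r// /K; nia.
  apply: (@le_trans _ _ ((d.+1 * (2 * n) * (24 * d.+1 * n) ^ d.+1)%:R * (2 * n%:R ^- (d + 4)))).
    by rewrite ler_wpM2r ?ler_nat// mulr_ge0// invr_ge0 exprn_ge0.
  rewrite !natrM !natrX !natrM !exprMn.
  have nd : n%:R ^+ d.+1 != 0 :> R by rewrite expf_neq0// lt0r_neq0.
  have -> : n%:R ^- (d + 4) = n%:R ^- d.+1 * n%:R^-1 * n%:R ^- 2 :> R.
    rewrite (_ : (d + 4 = d.+1 + 3)%N) 1?exprD; last lia.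
    by field; rewrite nd lt0r_neq0.
  by rewrite le_eqVlt; apply/orP; left; apply/eqP; field; rewrite nd lt0r_neq0.
move=> omega nB i N z Nn hz.
pose q : mpoly d.+1 R := \sum_(lo <= m < N.+1) mderiv i (random_poly p a xi omega m).
have qE (y : 'rV[R]_d.+1) : \sum_(lo <= m < N.+1) meval (y 0) (mderiv i (random_poly p a xi omega m)) =
    meval (y 0) q by rewrite /q (raddf_sum (meval (y 0))).
have hq : mdeg_le n q.
  rewrite /q big_nat_cond; apply: mdeg_le_sum => m /andP[/andP[_ mN] _].
  apply: (@dhomog_mdeg_le _ _ m.-1); first lia.
  apply: dhomog_mderiv; rewrite /random_poly.
  by apply: rpred_sum => l _; apply: dhomogZ; exact: hp.
rewrite qE.
have h : forall c : {ffun 'I_d.+1 -> 'I_K.*2.+1},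
    `|meval (sphere_net R c 0) q| <= tau * Num.sqrt (4 * V).
  move=> c; rewrite leNgt; apply/negP => hc; apply: nB.
  have Nn' : (N < n.+1)%N by [].
  pose x : I := (i, Ordinal Nn', c).
  rewrite (big_rem x) ?mem_enum//=; left; rewrite /E /= qE; exact: hc.
apply: le_trans (sphere_net_le n0 (erefl _) hq h hz) _.
(* The square of [2 tau sqrt (4 V)] is [32 (d + 4) V log n], where the first 2 is lost in passing
   from the net to the sphere. *)
rewrite -(@ler_pXn2r _ 2) ?nnegrE ?mulrn_wge0 ?mulr_ge0 ?sqrtr_ge0//.
rewrite -[leLHS]/((_ *+ 2) ^+ 2) -[_ *+ 2]mulr_natr !exprMn /tau.
rewrite !sqr_sqrtr ?mulr_ge0 ?(ltW ln0)//.
by rewrite le_eqVlt; apply/orP; left; apply/eqP; ring.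
Qed.

(** Telescoping, as [1 / (k + 2)^2 <= 1 / (k + 1) - 1 / (k + 2)]. *)
Lemma sum_inv_sq_le (R : realType) (M : nat) :
  \sum_(k < M) k.+2%:R ^- 2 <= 1 :> R.
Proof.
suff : \sum_(k < M) k.+2%:R ^- 2 <= 1 - M.+1%:R^-1 :> R.
  by move=> /le_trans; apply; rewrite lerBlDr lerDl invr_ge0.
elim: M => [|M IH]; first by rewrite big_ord0 invr1 subrr.
rewrite big_ord_recr /=; apply: le_trans (lerD IH (lexx _)) _.
have : 0 < M.+1%:R :> R by rewrite ltr0n.
rewrite -(natr1 M.+1); move: (M.+1%:R) => x x0.
have x1 : 0 < x + 1 by lra.
rewrite -subr_ge0.
have -> : 1 - (x + 1)^-1 - (1 - x^-1 + (x + 1) ^- 2) = (x * (x + 1) ^+ 2)^-1.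
  by field; rewrite !lt0r_neq0.
by rewrite invr_ge0 mulr_ge0 ?sqr_ge0// ltW.
Qed.

(** Borel-Cantelli. The base [k.+2] is the lower bound available for [n k.+1]. *)
Lemma ae_eventually_not (dO : measure_display) (Omega : measurableType dO)
    (R : realType) (P : probability Omega R) (B : nat -> set Omega) (C : R) :
  0 <= C -> (forall k, measurable (B k)) ->
  (forall k, (P (B k) <= (C * k.+2%:R ^- 2)%R%:E)%E) ->
  {ae P, forall omega, exists k0, forall k, (k0 <= k)%N -> ~ B k omega}.
Proof.
move=> C0 mB PB.
have PB0 : P (lim_sup_set B) = 0.
  apply: lim_sup_set_cvg0 => //; apply: (@le_lt_trans _ _ C%:E); last exact: ltry.
  apply: lime_le; first by apply: is_cvg_nneseries => k _ _; exact: measure_ge0.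
  apply: nearW => M; rewrite big_mkord.
  apply: (@le_trans _ _ (\sum_(k < M) (C * k.+2%:R ^- 2)%R%:E)%E).
    by apply: lee_sum => k _; exact: PB.
  by rewrite sumEFin lee_fin -mulr_sumr -[leRHS]mulr1 ler_wpM2l// sum_inv_sq_le.
exists (lim_sup_set B); split => //.
  apply: bigcap_measurableType => k _.
  by apply: bigcup_measurable => j _; exact: mB.
move=> omega /= hn k _; apply: contrapT => hk; apply: hn; exists k => j kj Bj.
by apply: hk; exists j.
Qed.

Theorem corollary6p1 (R : realType) (d : nat) (hd : (1 <= d)%N)
    (w : R -> R) (hw : weight w)
    (L : nat -> nat)
    (Y : forall m : nat, 'I_(L m).+1 -> 'rV[R]_d.+1 -> R)
    (hY : forall (m : nat) (l : 'I_(L m).+1), spherical_harmonic m (Y m l))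
    (hY1 : forall (m : nat) (l : 'I_(L m).+1) (z : 'rV[R]_d.+1),
       unit_sphere z -> `|Y m l z| <= 1)
    (dO : measure_display) (Omega : measurableType dO)
    (P : probability Omega R)
    (xi : {m : nat & 'I_(L m).+1} -> {RV P >-> R})
    (hxi : subnormal_sequence xi)
    (a : forall m : nat, 'I_(L m).+1 -> R)
    (n : nat -> nat) (n_gt0 : forall k : nat, (0 < n k)%N)
    (n_incr : forall k : nat, (n k < n k.+1)%N)
    (C1 C2 : R) (hC1 : 0 < C1) (hC2 : 0 < C2)
    (hg : forall k : nat,
       growth w (n k.+1)%:R <= C1 * growth w (n k)%:R)
    (hsum : forall k : nat,
       \sum_(1 <= i < k.+1)
         Num.sqrt ((\sum_((n i.-1).+1 <= m < (n i).+1)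
                      m%:R ^+ 2 * sqnorm a m) * ln (n i)%:R)
       <= C2 / w (1 - ((n k)%:R)^-1)) :
  {ae P, forall omega : Omega,
     (forall x : 'rV[R]_d.+1, unit_ball x ->
        cvgn (series (random_term Y a xi omega x))) /\
     bloch w (random_series Y a xi omega)}.
Proof.
pose p m (l : 'I_(L m).+1) : mpoly d.+1 R := projT1 (cid (hY m l)).
have pP m l : [/\ p m l \is ishomog1 m mdeg,
    harmonic_on setT (fun x : 'rV[R]_d.+1 => meval (x 0) (p m l)) &
    forall z, unit_sphere z -> Y m l z = meval (z 0) (p m l)] := projT2 (cid (hY m l)).
have php m l : p m l \is ishomog1 m mdeg by have [] := pP m l.
have p1 m l (y : 'rV[R]_d.+1) : unit_sphere y -> `|meval (y 0) (p m l)| <= 1.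
  by move=> hy; have [_ _ <-] := pP m l; rewrite ?hY1.
pose h omega m := random_poly p a xi omega m.
have hh omega m : h omega m \is ishomog1 m mdeg.
  by rewrite /h /random_poly; apply: rpred_sum => l _; apply: dhomogZ; exact: php.
have termE omega : random_term Y a xi omega =
    (fun (x : 'rV[R]_d.+1) m => meval (x 0) (h omega m)).
  apply/funext => x; apply/funext => m.
  rewrite /random_term /h /random_poly (raddf_sum (meval (x 0))).
  apply: eq_bigr => l _; rewrite /= mevalZ (meval_polar x (php m l)) /solid.
  by have [_ _ ->] := pP m l; last exact: direction_unit.
have lap omega m (x : 'rV[R]_d.+1) :
    \sum_i meval (x 0) (mderiv i (mderiv i (h omega m))) = 0.
  transitivity (\sum_i \sum_(l < (L m).+1) (a m l * xi (Tagged (fun m => 'I_(L m).+1) l) omega) *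
      meval (x 0) (mderiv i (mderiv i (p m l)))).
    have ms k (f : 'I_k -> mpoly d.+1 R) i :
      mderiv i (\sum_l f l) = \sum_l mderiv i (f l) by exact: raddf_sum.
    apply: eq_bigr => i _; rewrite /h /random_poly !ms.
    by rewrite (raddf_sum (meval (x 0))); apply: eq_bigr => l _; rewrite /= !mderivZ mevalZ.
  rewrite exchange_big big1// => l _; rewrite -mulr_sumr.
  have [_ [_ /(_ x I)]] := pP m l; rewrite /laplacian.
  by under eq_bigr do rewrite !partial_meval; move=> -> _; rewrite mulr0.
have nk k : (k < n k)%N by elim: k => // k IH; exact: leq_ltn_trans IH (n_incr k).
have n1 k : (1 < n k.+1)%N by apply: leq_ltn_trans (nk k.+1).
(* [B k] is the bad event of the block [n_k < m <= n_(k+1)]; the shift ensures that the upper end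
   exceeds 1, so that its logarithm is positive. *)
pose B k := projT1 (cid (random_block_event a (n k).+1 hxi php p1 (n1 k))).
have BP k := projT2 (cid (random_block_event a (n k).+1 hxi php p1 (n1 k))).
set D := (d.+1 * 2 * (24 * d.+1) ^ d.+1 * 2)%N in BP.
set C3 := Num.sqrt (32 * (d + 4)%:R) in BP.
have := @ae_eventually_not _ _ _ P B D%:R (ler0n _ _).
have mB k : measurable (B k) by have [] := BP k.
have PB k : (P (B k) <= (D%:R * k.+2%:R ^- 2)%R%:E)%E.
  have [_ /le_trans + _] := BP k; apply.
  rewrite lee_fin ler_wpM2l// lef_pV2 ?posrE ?exprn_gt0 ?ltr0n//.
  by rewrite lerXn2r ?nnegrE// ler_nat.
move=> /(_ mB PB); apply: filterS => omega [k0 hk0].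
have g1 : 0 < growth w 1 := growth_gt0 hw (lexx _).
pose nrm (q : mpoly d.+1 R) := \sum_(m <- msupp q) `|mcoeff m q|.
have nrm0 q : 0 <= nrm q by apply: sumr_ge0.
(* [A0] depends on [omega] but bounds the sums of degree up to [n k0] for every coordinate and every
   point of the sphere. Dividing it by [growth w 1] below turns it into a multiple of the growth
   function. *)
pose A0 := \sum_i \sum_(m < (n k0).+1) nrm (mderiv i (h omega m)).
have A00 : 0 <= A0 by apply: sumr_ge0 => i _; apply: sumr_ge0.
have C30 : 0 <= C3 by exact: sqrtr_ge0.
have main N i (z : 'rV[R]_d.+1) : unit_sphere z ->
    `|\sum_(m < N.+1) meval (z 0) (mderiv i (h omega m))| <=
    (A0 / growth w 1 + C1 * C2 * C3) * growth w N.+1%:R.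
  move=> hz; pose t k := Num.sqrt ((\sum_((n k.-1).+1 <= m < (n k).+1)
                      m%:R ^+ 2 * sqnorm a m) * ln (n k)%:R).
  have := @block_growth_le _ w n C1 C2 C3 A0 t
    (fun m => meval (z 0) (mderiv i (h omega m))) k0 hw n_gt0 n_incr
    (ltW hC1) (ltW hC2) C30 (fun k => sqrtr_ge0 _) hg hsum.
  move=> H; rewrite -(big_mkord xpredT (fun m => meval (z 0) (mderiv i (h omega m)))).
  apply: le_trans (H _ _ N) _.
  - move=> M Mn; rewrite big_mkord (le_trans (ler_norm_sum _ _ _))//.
    rewrite /A0 (bigD1 i)//= -[leLHS]addr0; apply: lerD; last first.
      by apply: sumr_ge0 => j _; apply: sumr_ge0.
    apply: (@le_trans _ _ (\sum_(m < M.+1) nrm (mderiv i (h omega m)))).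
      by apply: ler_sum => m _; exact: meval_coef_le.
    rewrite -!(big_mkord xpredT (fun m => nrm (mderiv i (h omega m)))).
    by rewrite [leRHS](@big_cat_nat _ _ _ M.+1)//= lerDl sumr_ge0.
  - move=> k M kk0 /andP[_ Mn].
    by have [_ _ /(_ omega (hk0 k kk0) i M z Mn hz)] := BP k.
  - rewrite mulrDl lerD2r -mulrA ler_peMr//.
    by rewrite ler_pdivlMl// mulr1 growth_le// ler1n.
have Cge0 : 0 <= A0 / growth w 1 + C1 * C2 * C3.
  by rewrite addr_ge0 ?divr_ge0 ?(ltW g1)// !mulr_ge0// ltW.
have [c1 c2] := sumseries_bloch hw Cge0 (hh omega) (lap omega) main.
split; first by move=> x hx; rewrite termE; exact: c1.
suff -> : random_series Y a xi omega = sumseries (h omega) by [].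
by apply/funext => x; rewrite /random_series termE.
Qed.
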